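(* Let $R$ be a commutative Noetherian ring, $n$ a positive integer, and $U$, $V$ free $R$-modules of rank $3$ and $2n+1$, respectively. Let $v_0\in V$ generate a free summand of rank $1$, let $w_0\in V^*$ satisfy $w_0(v_0)=1$, and let $V'=\ker w_0$, so that $V=Rv_0\oplus V'$. Let $$\phi=\phi'+(v_0\wedge v_0')\in \textstyle\bigwedge^2V,\qquad \phi'\in\bigwedge^2V',\ v_0'\in V',$$ and let $x:U\to R$ be an $R$-module homomorphism. Assume: (a) the ideal $\operatorname{im}(x:U\to R)$ has grade three; (b) the ideal $\operatorname{im}(\phi^{(n)}:\bigwedge^{2n}V^*\to R)$ is a grade three Gorenstein ideal; (c) $\operatorname{im}(v_0':V^*\to R)\subseteq \operatorname{im}(x:U\to R)$; (d) the element $v_0\wedge\phi^{(n)}$ of $\bigwedge^{2n+1}V$ is regular. Let $\mathcal I$ be the ideal $$\mathcal I=\operatorname{im}\Big((V'\wedge\phi^{(n)}):\textstyle\bigwedge^{2n+1}V^*\to R\Big)+\operatorname{im}(x)\cdot\operatorname{im}\Big(v_0\wedge\phi^{(n)}:\bigwedge^{2n+1}V^*\to R\Big)$$ of $R$. Let $q:V^*\to U$ be an $R$-module homomorphism with $x\circ q=v_0'$ as maps $V^*\to R$, and let $B:\bigwedge^{2n+1}V^*\to\bigwedge^2U$ be an $R$-module homomorphism with $x(B(w))=q(\phi^{(n)}(w))$ in $U$ for all $w\in\bigwedge^{2n+1}V^*$. Let $\operatorname{proj}:V\to V'$ be $\operatorname{proj}(v)=v-w_0(v)\cdot v_0$.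 Then the maps and modules $$0\to \textstyle\bigwedge^{2n+1}V^*\oplus\bigwedge^3U\xrightarrow{\ d_3\ } V^*\oplus\bigwedge^2U\xrightarrow{\ d_2\ }V'\oplus U\xrightarrow{\ d_1\ }\bigwedge^{2n+1}V$$ form a resolution of $R/\mathcal I$ by free $R$-modules, where $$d_3\begin{pmatrix} w_{2n+1} \\ {u_3} \end{pmatrix}=\begin{pmatrix} \phi^{(n)}(w_{2n+1}) \\ B(w_{2n+1})+x(u_3) \end{pmatrix},\qquad d_2\begin{pmatrix} w_1 \\ {u_2} \end{pmatrix}=\begin{pmatrix} \operatorname{proj}(w_1(\phi)) \\ -q(w_1)+x(u_2) \end{pmatrix},$$ $$d_1\begin{pmatrix} v' \\ {u_1} \end{pmatrix}=(v'+x(u_1)\cdot v_0)\wedge\phi^{(n)},$$ for $w_{2n+1}\in\bigwedge^{2n+1}V^*$, $u_3\in\bigwedge^3U$, $w_1\in V^*$, $u_2\in\bigwedge^2U$, $v'\in V'$, $u_1\in U$.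
   Context: $V^*=\operatorname{Hom}_R(V,R)$. $\bigwedge^\bullet V$ and $\bigwedge^\bullet V^*$ act on each other in the standard way by contraction, each being a module over the other: e.g. $w(v\wedge v')=w(v)v'-w(v')v$ for $w\in V^*$, $v,v'\in V$, and $(a\wedge b)(w)=a(b(w))$ for $a,b\in\bigwedge^\bullet V$, $w\in\bigwedge^\bullet V^*$. Elements of $\bigwedge^pV$ act on $\bigwedge^pV^*$ with values in $R$ by the perfect pairing, and in particular $v\in V$ is regarded as a map $V^*\to R$, $w\mapsto w(v)$. $\phi^{(n)}\in\bigwedge^{2n}V$ is the $n$-th divided power of $\phi$ (its coefficients are the Pfaffians of order $2n$ of the alternating matrix of $\phi$). $\operatorname{im}((V'\wedge\phi^{(n)}):\bigwedge^{2n+1}V^*\to R)$ is the ideal of all values $(v'\wedge\phi^{(n)})(w)$, $v'\in V'$, $w\in\bigwedge^{2n+1}V^*$. The maps $x:\bigwedge^iU\to\bigwedge^{i-1}U$ are the Koszul differentials given by contraction with $x\in U^*$. An element of the rank one free module $\bigwedge^{2n+1}V\cong R$ is regular if it corresponds to a non-zerodivisor. A grade three Gorenstein ideal $K$ is a perfect ideal of grade $3$ with $\operatorname{Ext}^3_R(R/K,R)\cong R/K$. Under these hypotheses, homomorphisms $q$ and $B$ with the required properties exist. ''Resolution of $R/\mathcal I$'' means that the displayed sequence is an exact complex except at $\bigwedge^{2n+1}V\cong R$, where the cokernel of $d_1$ is $R/\mathcal I$. *)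

(* Defs.v *)
From HB Require Import structures.
From mathcomp Require Import all_boot all_algebra ring_quotient.
From mathcomp Require Import boolp.

Set Implicit Arguments.
Unset Strict Implicit.
Unset Printing Implicit Defensive.

Import GRing.Theory.
Local Open Scope ring_scope.

Section Submodules.
Variables (R : comNzRingType) (M : lmodType R).

Definition submod_gen (A : M -> Prop) : {pred M} := fun x =>
  `[< exists k (c : 'I_k -> R) (y : 'I_k -> M),
        (forall i, A (y i)) /\ x = \sum_(i < k) c i *: y i >].

Lemma sub_submod_gen (A : M -> Prop) (x : M) : A x -> x \in submod_gen A.
Proof.
move=> Ax; apply/asboolP; exists 1, (fun=> 1), (fun=> x); split=> //.
by rewrite big_ord1 scale1r.
Qed.

Fact submod_gen_closed (A : M -> Prop) : submod_closed (submod_gen A).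
Proof.
split=> [|a x y /asboolP[k [c [z [Az ->]]]] /asboolP[l [d [t [At ->]]]]].
  by apply/asboolP; exists 0, (fun=> 0), (fun=> 0); split=> [[]//|]; rewrite big_ord0.
apply/asboolP; exists (k + l)%N.
exists (fun i => match split i with inl j => a * c j | inr j => d j end).
exists (fun i => match split i with inl j => z j | inr j => t j end).
split=> [i|]; first by case: (split i).
rewrite big_split_ord /= scaler_sumr; congr (_ + _); apply: eq_bigr => i _.
  by rewrite (unsplitK (inl _ i)) scalerA.
by rewrite (unsplitK (inr _ i)).
Qed.

HB.instance Definition _ (A : M -> Prop) :=
  GRing.isSubmodClosed.Build R M (submod_gen A) (submod_gen_closed A).

Lemma mem_submod_genE (A : M -> Prop) (x : M) :
  A 0 -> (forall a u v, A u -> A v -> A (a *: u + v)) ->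
  x \in submod_gen A <-> A x.
Proof.
move=> A0 Alin; split; last exact: sub_submod_gen.
move=> /asboolP[k [c [y [Ay ->]]]]; elim: k => [|k IHk] in c y Ay *.
  by rewrite big_ord0.
by rewrite big_ord_recl; apply: Alin => //; apply: IHk.
Qed.

End Submodules.

Section Submodule.
Variables (R : comNzRingType) (M : lmodType R) (N : submodClosed M).

Record submod := Submod { submod_val :> M; _ : submod_val \in N }.

HB.instance Definition _ := [isSub of submod for submod_val].
HB.instance Definition _ := [Choice of submod by <:].
HB.instance Definition _ := [SubChoice_isSubLmodule of submod by <:].

End Submodule.

Section QuotientModule.
Variables (R : comNzRingType) (M : lmodType R) (N : submodClosed M).

Definition submod_pred : {pred M} := fun x => x \in N.
Fact submod_zmod_closed : zmod_closed submod_pred.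
Proof.
split=> [|x y Nx Ny]; first exact: (@rpred0 _ N).
by rewrite -scaleN1r; apply: (@rpredD _ N) => //; apply: rpredZ.
Qed.
HB.instance Definition _ := GRing.isZmodClosed.Build M submod_pred submod_zmod_closed.

Definition quotmod := Quotient.quot submod_pred.
HB.instance Definition _ := GRing.Zmodule.on quotmod.

Definition quotmod_pi (x : M) : quotmod := (\pi_(Quotient.quot submod_pred) x)%qT.

Lemma quotmod_piB : zmod_morphism quotmod_pi.
Proof. exact: pi_is_zmod_morphism. Qed.
HB.instance Definition _ :=
  GRing.isZmodMorphism.Build M quotmod quotmod_pi quotmod_piB.

Lemma quotmod_pi_eq (x y : M) : quotmod_pi x = quotmod_pi y <-> x - y \in N.
Proof.
rewrite -[x - y \in N]/(x - y \in submod_pred) Quotient.idealrBE.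
by split=> /eqP.
Qed.

Lemma quotmod_pi_repr (z : quotmod) : exists x, quotmod_pi x = z.
Proof. by exists (repr z); rewrite /quotmod_pi reprK. Qed.

Definition quotmod_scale (a : R) (z : quotmod) : quotmod :=
  quotmod_pi (a *: repr (z : Quotient.quot submod_pred)).

Lemma quotmod_scale_pi a x : quotmod_scale a (quotmod_pi x) = quotmod_pi (a *: x).
Proof.
apply/quotmod_pi_eq; rewrite -scalerBr; apply: rpredZ; apply/quotmod_pi_eq.
by rewrite /quotmod_pi reprK.
Qed.

Fact quotmod_scaleA a b z :
  quotmod_scale a (quotmod_scale b z) = quotmod_scale (a * b) z.
Proof. by have [x <-] := quotmod_pi_repr z; rewrite !quotmod_scale_pi scalerA. Qed.
Fact quotmod_scale1 : left_id 1 quotmod_scale.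
Proof. by move=> z; have [x <-] := quotmod_pi_repr z; rewrite quotmod_scale_pi scale1r. Qed.
Fact quotmod_scaleDr : right_distributive quotmod_scale +%R.
Proof.
move=> a z t; have [x <-] := quotmod_pi_repr z; have [y <-] := quotmod_pi_repr t.
by rewrite -raddfD !quotmod_scale_pi scalerDr raddfD.
Qed.
Fact quotmod_scaleDl z : {morph quotmod_scale^~ z : a b / a + b}.
Proof.
by move=> a b; have [x <-] := quotmod_pi_repr z; rewrite !quotmod_scale_pi scalerDl raddfD.
Qed.
HB.instance Definition _ := GRing.Zmodule_isLmodule.Build R quotmod
  quotmod_scaleA quotmod_scale1 quotmod_scaleDr quotmod_scaleDl.

Fact quotmod_pi_scalable : scalable quotmod_pi.
Proof. by move=> a x; rewrite -quotmod_scale_pi. Qed.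
HB.instance Definition _ :=
  GRing.isScalable.Build R M quotmod *:%R quotmod_pi quotmod_pi_scalable.

End QuotientModule.

Section Kernel.
Variables (R : comNzRingType) (M N : lmodType R) (f : {linear M -> N}).

Definition kerp : {pred M} := [pred x | f x == 0].
Fact kerp_submod_closed : submod_closed kerp.
Proof.
split=> [|a x y]; rewrite !inE ?linear0 // => /eqP fx /eqP fy.
by rewrite linearP fx fy scaler0 addr0.
Qed.
HB.instance Definition _ := GRing.isSubmodClosed.Build R M kerp kerp_submod_closed.

End Kernel.

Section HomModule.
Variables (R : comNzRingType) (M N : lmodType R).

Definition hommod : Type := {linear M -> N}.
Definition hom_fun (f : hommod) : {linear M -> N} := f.
Coercion hom_fun : hommod >-> GRing.Linear.type.
HB.instance Definition _ := gen_eqMixin hommod.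
HB.instance Definition _ := gen_choiceMixin hommod.

Lemma hommodP (f g : hommod) : (forall x, f x = g x) -> f = g.
Proof.
case: f g => [f [[f1] [f2]]] [g [[g1] [g2]]] /= /funext eq_fg.
move: f1 f2 g1 g2; rewrite eq_fg => *.
by do !f_equal; apply: Prop_irrelevance.
Qed.

Definition hom_zero : hommod := (\0 : {linear M -> N}).
Definition hom_opp (f : hommod) : hommod := (-1 \*: f : {linear M -> N}).
Definition hom_add (f g : hommod) : hommod := (f \+ g : {linear M -> N}).
Definition hom_scale (a : R) (f : hommod) : hommod := (a \*: f : {linear M -> N}).

Fact hom_addA : associative hom_add.
Proof. by move=> f g h; apply: hommodP => x /=; rewrite addrA. Qed.
Fact hom_addC : commutative hom_add.
Proof. by move=> f g; apply: hommodP => x /=; rewrite addrC. Qed.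
Fact hom_add0 : left_id hom_zero hom_add.
Proof. by move=> f; apply: hommodP => x /=; rewrite add0r. Qed.
Fact hom_addN : left_inverse hom_zero hom_opp hom_add.
Proof. by move=> f; apply: hommodP => x /=; rewrite scaleN1r addNr. Qed.
HB.instance Definition _ :=
  GRing.isZmodule.Build hommod hom_addA hom_addC hom_add0 hom_addN.

Fact hom_scaleA a b f : hom_scale a (hom_scale b f) = hom_scale (a * b) f.
Proof. by apply: hommodP => x /=; rewrite scalerA. Qed.
Fact hom_scale1 : left_id 1 hom_scale.
Proof. by move=> f; apply: hommodP => x /=; rewrite scale1r. Qed.
Fact hom_scaleDr : right_distributive hom_scale +%R.
Proof. by move=> a f g; apply: hommodP => x /=; rewrite scalerDr. Qed.
Fact hom_scaleDl f : {morph hom_scale^~ f : a b / a + b}.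
Proof. by move=> a b; apply: hommodP => x /=; rewrite scalerDl. Qed.
HB.instance Definition _ := GRing.Zmodule_isLmodule.Build R hommod
  hom_scaleA hom_scale1 hom_scaleDr hom_scaleDl.

End HomModule.

Section HomFunctor.
Variables (R : comNzRingType) (M M' N : lmodType R) (d : {linear M' -> M}).

Definition hom_pre (f : hommod M N) : hommod M' N := (f \o d : {linear M' -> N}).

Fact hom_pre_linear : linear hom_pre.
Proof. by move=> a f g; apply: hommodP. Qed.
HB.instance Definition _ :=
  GRing.isLinear.Build R (hommod M N) (hommod M' N) *:%R hom_pre hom_pre_linear.

End HomFunctor.
Arguments hom_pre {R M M'} N d f.

Section Homology.
Variables (R : comNzRingType) (A B C : lmodType R).
Variables (f : {linear A -> B}) (g : {linear B -> C}).

(* ker g / (im f :&: ker g); it is only used when g \o f = 0. *)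
Definition boundary (z : submod (kerp g)) : Prop := exists x, f x = val z.
Definition homology := quotmod (submod_gen boundary).
HB.instance Definition _ := GRing.Lmodule.on homology.

End Homology.

Section HomologicalAlgebra.
Variable R : comNzRingType.

Definition exact (A B C : lmodType R) (f : A -> B) (g : B -> C) : Prop :=
  forall y, g y = 0 <-> exists x, f x = y.

Definition surjective (A B : Type) (f : A -> B) : Prop := forall y, exists x, f x = y.

Definition isomorphic (A B : lmodType R) : Prop :=
  exists f : {linear A -> B}, bijective f.

Definition free_module (M : lmodType R) : Prop := exists n, isomorphic M 'rV[R]_n.

Definition projective (P : lmodType R) : Prop :=
  forall (A B : lmodType R) (f : {linear A -> B}) (g : {linear P -> B}),
    surjective f -> exists h : {linear P -> A}, forall x, f (h x) = g x.

Definition projective_resolution (M : lmodType R) (P : nat -> lmodType R)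
    (d : forall i, {linear P i.+1 -> P i}) (e : {linear P 0%N -> M}) : Prop :=
  [/\ forall i, projective (P i), surjective e, exact (d 0%N) e &
      forall i, exact (d i.+1) (d i)].

Definition pd_le (M : lmodType R) (k : nat) : Prop :=
  exists P d e, [/\ @projective_resolution M P d e &
                    forall i, (k < i)%N -> forall x : P i, x = 0].

Definition has_pd (M : lmodType R) (k : nat) : Prop :=
  pd_le M k /\ forall j, pd_le M j -> (k <= j)%N.

(* E is (isomorphic to) Ext^(i+1)_R(M, N), computed from some projective
   resolution of M; the isomorphism class does not depend on the resolution. *)
Definition is_ExtS (i : nat) (M N E : lmodType R) : Prop :=
  exists P d e, @projective_resolution M P d e /\
    isomorphic E (homology (hom_pre N (d i)) (hom_pre N (d i.+1))).

End HomologicalAlgebra.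

Section Ideals.
Variable R : comNzRingType.

Definition is_ideal (I : R -> Prop) : Prop :=
  I 0 /\ forall a x y, I x -> I y -> I (a * x + y).

Definition ideal_gen (A : R -> Prop) : {pred R} := submod_gen (A : R^o -> Prop).

Definition ideal_add (I J : R -> Prop) : R -> Prop :=
  fun r => exists a b, [/\ I a, J b & r = a + b].

Definition ideal_mul (I J : R -> Prop) : R -> Prop :=
  fun r => r \in ideal_gen (fun s => exists a b, [/\ I a, J b & s = a * b]).

(* R/I when I is an ideal; in general R/(I). *)
Definition ring_mod (I : R -> Prop) : lmodType R := quotmod (submod_gen (I : R^o -> Prop)).

Definition noetherian : Prop :=
  forall I, is_ideal I ->
    exists s : seq R, forall r, I r <-> r \in ideal_gen (fun y => y \in s).

Definition nonzerodivisor (a : R) : Prop := forall r, a * r = 0 -> r = 0.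

Definition regular_sequence (s : seq R) : Prop :=
  1 \notin ideal_gen (fun y => y \in s) /\
  forall i r, (i < size s)%N ->
    s`_i * r \in ideal_gen (fun y => y \in take i s) ->
    r \in ideal_gen (fun y => y \in take i s).

(* The grade of the unit ideal is infinite, so only proper ideals have grade g. *)
Definition has_grade (I : R -> Prop) (g : nat) : Prop :=
  [/\ ~ I 1,
      exists s, [/\ regular_sequence s, forall y, y \in s -> I y & size s = g] &
      forall s, regular_sequence s -> (forall y, y \in s -> I y) -> (size s <= g)%N].

Definition perfect_ideal (I : R -> Prop) (g : nat) : Prop :=
  [/\ is_ideal I, has_grade I g & has_pd (ring_mod I) g].

Definition gorenstein_grade3 (I : R -> Prop) : Prop :=
  perfect_ideal I 3 /\ is_ExtS 2 (ring_mod I) R^o (ring_mod I).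

Definition free_resolution3 (M F3 F2 F1 F0 : lmodType R)
    (d3 : F3 -> F2) (d2 : F2 -> F1) (d1 : F1 -> F0) : Prop :=
  [/\ [/\ free_module F3, free_module F2, free_module F1 & free_module F0],
      [/\ linear d3, linear d2 & linear d1],
      [/\ injective d3, exact d3 d2 & exact d2 d1] &
      exists e : {linear F0 -> M}, surjective e /\ exact d1 e].

End Ideals.

(* The exterior algebra of the free module R^m with basis e_0, ..., e_(m-1):
   a : extalg R m stands for \sum_S a S *: e_S, where for S = {i_1 < ... < i_p}
   e_S = e_(i_1) /\ ... /\ e_(i_p).  For V free with its chosen basis, /\V and
   /\V^* are both written this way, in that basis and in the dual basis. *)
Section ExteriorAlgebra.
Variables (R : comNzRingType) (m : nat).

Definition extalg : Type := {ffun {set 'I_m} -> R^o}.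
HB.instance Definition _ := GRing.Lmodule.on extalg.
Definition ext_coef (a : extalg) : {set 'I_m} -> R := a.
Coercion ext_coef : extalg >-> Funclass.

Implicit Types (S T K : {set 'I_m}) (a b c t : extalg).

Definition ext_basis S : extalg := [ffun T => (T == S)%:R].

(* e_S /\ e_T = ext_sign S T *: e_(S :|: T) for disjoint S and T. *)
Definition ext_sign S T : R := (-1) ^+ (\sum_(i in S) \sum_(j in T) (j < i))%N.

Definition wedge a b : extalg :=
  [ffun K : {set 'I_m} => \sum_(S : {set 'I_m} | S \subset K)
     ext_sign S (K :\: S) * a S * b (K :\: S)].

Definition ext1 : extalg := ext_basis set0.

(* a(t), for a in /\V and t in /\V^* or the other way round; the sign is forced
   by the antiderivation rule for elements of degree 1 and (a /\ b)(t) = a(b(t)),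
   see contr_wedge and contr_deg1_wedge below. *)
Definition contr a t : extalg :=
  [ffun K : {set 'I_m} => \sum_(S : {set 'I_m} | [disjoint S & K])
     ext_sign S (S :|: K) * a S * t (S :|: K)].

(* The component in /\^0 = R of a(t): on /\^p V and /\^p V^* this is the perfect
   pairing. *)
Definition ext_pair a t : R := contr a t set0.

(* If a = \sum_S t_S with t_S a multiple of e_S, #|S| = 2, then t_S has zero
   divided powers of order > 1, so a^(n) is the sum of all products of n
   distinct t_S. *)
Definition divpow (n : nat) a : extalg :=
  \sum_(P : {set {set 'I_m}} | (#|P| == n) && [forall S in P, #|S| == 2%N])
    \big[wedge/ext1]_(S in P) (a S *: ext_basis S).

Definition homog (p : nat) : {pred extalg} :=
  fun a => [forall S, (a S != 0) ==> (#|S| == p)].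

Lemma homogP p a : reflect (forall S, #|S| != p -> a S = 0) (a \in homog p).
Proof.
apply: (iffP forallP) => [h S|h S].
  by apply: contraNeq => aS; have := h S; rewrite aS.
by apply/implyP; apply: contraR => /h ->.
Qed.

Fact homog_submod_closed p : submod_closed (homog p).
Proof.
split=> [|x a b /homogP ha /homogP hb]; apply/homogP => S Sp.
  by rewrite /ext_coef ffunE.
by rewrite /ext_coef !ffunE [a S]ha // [b S]hb // scaler0 addr0.
Qed.
HB.instance Definition _ p :=
  GRing.isSubmodClosed.Build R extalg (homog p) (homog_submod_closed p).

Definition extpow (p : nat) : Type := submod (homog p).
HB.instance Definition _ p := GRing.Lmodule.on (extpow p).
Definition extpow_val p (a : extpow p) : extalg := submod_val a.
Coercion extpow_val : extpow >-> extalg.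

(* The projection onto /\^p, used to view elements known to be homogeneous of
   degree p as elements of /\^p (see hcompE). *)
Definition hcomp_val p a : extalg := [ffun S : {set 'I_m} => if #|S| == p then a S else 0].
Fact hcomp_subproof p a : hcomp_val p a \in homog p.
Proof. by apply/homogP => S /negPf Sp; rewrite /ext_coef ffunE Sp. Qed.
Definition hcomp p a : extpow p := Submod (hcomp_subproof p a).

Definition ext_deg1 (u : 'I_m -> R) : extalg := \sum_i u i *: ext_basis [set i].

(* The isomorphism /\^m (R^m) = R, e_0 /\ ... /\ e_(m-1) |-> 1 (see ext_top_bij). *)
Definition ext_top a : R := a [set: 'I_m].

End ExteriorAlgebra.


Section ExteriorTheory.
Variables (R : comNzRingType) (m : nat).
Implicit Types (S T K : {set 'I_m}) (a b c t : extalg R m).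
Local Notation sg := (@ext_sign R m).
Local Notation e := (@ext_basis R m).

Lemma wedgeE a b K :
  wedge a b K = \sum_(S : {set 'I_m} | S \subset K) sg S (K :\: S) * a S * b (K :\: S).
Proof. by rewrite /ext_coef /wedge ffunE. Qed.

Lemma contrE a t K :
  contr a t K = \sum_(S : {set 'I_m} | [disjoint S & K]) sg S (S :|: K) * a S * t (S :|: K).
Proof. by rewrite /ext_coef /contr ffunE. Qed.

Lemma ext_basisE S T : e S T = (T == S)%:R.
Proof. by rewrite /ext_coef ffunE. Qed.
Lemma ext_coef0 S : (0 : extalg R m) S = 0.
Proof. by rewrite /ext_coef ffunE. Qed.
Lemma ext_coefD a b S : (a + b : extalg R m) S = a S + b S.
Proof. by rewrite /ext_coef ffunE. Qed.
Lemma ext_coefZ (x : R) a S : (x *: a : extalg R m) S = x * a S.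
Proof. by rewrite /ext_coef ffunE. Qed.
Lemma ext_coef_sum (I : Type) (r : seq I) (P : pred I) (F : I -> extalg R m) S :
  (\sum_(i <- r | P i) F i : extalg R m) S = \sum_(i <- r | P i) F i S.
Proof.
elim/big_rec2: _ => [|i x y _ <-]; last by rewrite ext_coefD.
by rewrite ext_coef0.
Qed.
Lemma extalgP a b : (forall S, a S = b S) -> a = b.
Proof. by move=> ab; apply/ffunP => S; apply: ab. Qed.

Lemma extalg_sum a : a = \sum_S a S *: e S.
Proof.
apply: extalgP => T; rewrite ext_coef_sum (bigD1 T) //= big1.
  by rewrite ext_coefZ ext_basisE eqxx mulr1 addr0.
by move=> S; rewrite eq_sym => /negPf nS; rewrite ext_coefZ ext_basisE nS mulr0.
Qed.

Fact wedge_linear_r a : linear (wedge a).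
Proof.
move=> x b c; apply: extalgP => K; rewrite ext_coefD ext_coefZ !wedgeE.
rewrite mulr_sumr -big_split; apply: eq_bigr => S _ /=.
by rewrite ext_coefD ext_coefZ mulrDr mulrCA.
Qed.
HB.instance Definition _ a :=
  GRing.isLinear.Build R (extalg R m) (extalg R m) *:%R (wedge a) (wedge_linear_r a).

Lemma wedgePl x a c b : wedge (x *: a + c) b = x *: wedge a b + wedge c b.
Proof.
apply: extalgP => K; rewrite ext_coefD ext_coefZ !wedgeE.
rewrite mulr_sumr -big_split; apply: eq_bigr => S _ /=.
by rewrite ext_coefD ext_coefZ mulrDr mulrDl !mulrA [sg _ _ * x]mulrC.
Qed.
Lemma wedge0l b : wedge 0 b = 0.
Proof. by have := wedgePl (-1) 0 0 b; rewrite scaler0 addr0 scaleN1r addNr. Qed.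
Lemma wedgeZl x a b : wedge (x *: a) b = x *: wedge a b.
Proof. by have := wedgePl x a 0 b; rewrite !addr0 wedge0l addr0. Qed.
Lemma wedgeDl a c b : wedge (a + c) b = wedge a b + wedge c b.
Proof. by have := wedgePl 1 a c b; rewrite !scale1r. Qed.

Fact contr_linear_r a : linear (contr a).
Proof.
move=> x b c; apply: extalgP => K; rewrite ext_coefD ext_coefZ !contrE.
rewrite mulr_sumr -big_split; apply: eq_bigr => S _ /=.
by rewrite ext_coefD ext_coefZ mulrDr mulrCA.
Qed.
HB.instance Definition _ a :=
  GRing.isLinear.Build R (extalg R m) (extalg R m) *:%R (contr a) (contr_linear_r a).

Lemma contrPl x a c t : contr (x *: a + c) t = x *: contr a t + contr c t.
Proof.
apply: extalgP => K; rewrite ext_coefD ext_coefZ !contrE.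
rewrite mulr_sumr -big_split; apply: eq_bigr => S _ /=.
by rewrite ext_coefD ext_coefZ mulrDr mulrDl !mulrA [sg _ _ * x]mulrC.
Qed.
Lemma contr0l t : contr 0 t = 0.
Proof. by have := contrPl (-1) 0 0 t; rewrite scaler0 addr0 scaleN1r addNr. Qed.
Lemma contrZl x a t : contr (x *: a) t = x *: contr a t.
Proof. by have := contrPl x a 0 t; rewrite !addr0 contr0l addr0. Qed.
Lemma contrDl a c t : contr (a + c) t = contr a t + contr c t.
Proof. by have := contrPl 1 a c t; rewrite !scale1r. Qed.

Lemma extalg_ind (P : extalg R m -> Prop) :
  (forall x a b, P a -> P b -> P (x *: a + b)) -> P 0 -> (forall S, P (e S)) ->
  forall a, P a.
Proof.
move=> Plin P0 Pe a; rewrite (extalg_sum a).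
by elim/big_rec: _ => // S b _ Pb; apply: Plin.
Qed.

Lemma big_setUd (A : nmodType) S T (F : 'I_m -> A) : [disjoint S & T] ->
  \sum_(i in S :|: T) F i = \sum_(i in S) F i + \sum_(i in T) F i.
Proof.
move=> dST; rewrite -bigU //=; apply: eq_bigl => i; by rewrite !inE.
Qed.

Lemma ext_signUl S S' T : [disjoint S & S'] -> sg (S :|: S') T = sg S T * sg S' T.
Proof. by move=> dS; rewrite /ext_sign -exprD; congr (_ ^+ _); apply: big_setUd. Qed.

Lemma ext_signUr S T T' : [disjoint T & T'] -> sg S (T :|: T') = sg S T * sg S T'.
Proof.
move=> dT; rewrite /ext_sign -exprD -big_split; congr (_ ^+ _).
by apply: eq_bigr => i _; apply: big_setUd.
Qed.

Lemma ext_sign_sqr S T : sg S T * sg S T = 1.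
Proof. by rewrite /ext_sign -expr2 sqrr_sign. Qed.

Lemma ext_sign0l T : sg set0 T = 1.
Proof. by rewrite /ext_sign big_set0. Qed.

Lemma ext_sign11 (i j : 'I_m) : sg [set i] [set j] = (-1) ^+ (j < i)%N.
Proof. by rewrite /ext_sign !big_set1. Qed.

Lemma wedge_basis S T :
  wedge (e S) (e T) = if [disjoint S & T] then sg S T *: e (S :|: T) else 0.
Proof.
apply: extalgP => K; rewrite wedgeE.
transitivity (if (S \subset K) && (K :\: S == T) then sg S T else 0).
  case: (boolP (S \subset K)) => SK /=; last first.
    rewrite big1 // => A AK; rewrite !ext_basisE; case: eqP => [AS|].
      by rewrite -AS AK in SK.
    by rewrite mulr0 mul0r.
  rewrite (bigD1 S) //= big1 ?addr0 => [|A /andP[_ /negPf nA]]; last first.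
    by rewrite ext_basisE nA mulr0 mul0r.
  rewrite !ext_basisE eqxx mulr1; case: eqP => [->|_]; first by rewrite mulr1.
  by rewrite mulr0.
have -> : (S \subset K) && (K :\: S == T) = [disjoint S & T] && (K == S :|: T).
  apply/andP/andP => [[SK /eqP <-]|[dST /eqP ->]].
    rewrite -setI_eq0 setIDA setIC -setIDA setDv setI0 eqxx; split=> //.
    by rewrite -{1}(setIidPr SK) setID.
  by rewrite subsetUl setDUl setDv set0U; split=> //; apply/eqP/setDidPl; rewrite disjoint_sym.
case: ifP => [/andP[-> /eqP ->]|]; first by rewrite ext_coefZ ext_basisE eqxx mulr1.
case: ifP => _; last by rewrite ext_coef0.
by rewrite ext_coefZ ext_basisE /= => ->; rewrite mulr0.
Qed.

Lemma contr_basis S T :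
  contr (e S) (e T) = if S \subset T then sg S T *: e (T :\: S) else 0.
Proof.
apply: extalgP => K; rewrite contrE.
transitivity (if [disjoint S & K] && (S :|: K == T) then sg S T else 0).
  case: (boolP [disjoint S & K]) => SK /=; last first.
    rewrite big1 // => A AK; rewrite !ext_basisE; case: eqP => [AS|].
      by rewrite -AS AK in SK.
    by rewrite mulr0 mul0r.
  rewrite (bigD1 S) //= big1 ?addr0 => [|A /andP[_ /negPf nA]]; last first.
    by rewrite ext_basisE nA mulr0 mul0r.
  rewrite !ext_basisE eqxx mulr1; case: eqP => [->|_]; first by rewrite mulr1.
  by rewrite mulr0.
have -> : [disjoint S & K] && (S :|: K == T) = (S \subset T) && (K == T :\: S).
  apply/andP/andP => [[dSK /eqP <-]|[ST /eqP ->]].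
    rewrite subsetUl setDUl setDv set0U; split=> //.
    by rewrite eq_sym; apply/eqP/setDidPl; rewrite disjoint_sym.
  rewrite -setI_eq0 setIDA setIC -setIDA setDv setI0 eqxx; split=> //.
  by rewrite -{1}(setIidPr ST) setID.
case: ifP => [/andP[-> /eqP ->]|]; first by rewrite ext_coefZ ext_basisE eqxx mulr1.
case: ifP => _; last by rewrite ext_coef0.
by rewrite ext_coefZ ext_basisE /= => ->; rewrite mulr0.
Qed.

Lemma wedge1l a : wedge (ext1 R m) a = a.
Proof.
elim/extalg_ind: a => [x a b Ha Hb||S].
- by rewrite linearP /= Ha Hb.
- by rewrite linear0.
by rewrite /ext1 wedge_basis -setI_eq0 set0I eqxx ext_sign0l scale1r set0U.
Qed.

Lemma wedgeA a b c : wedge a (wedge b c) = wedge (wedge a b) c.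
Proof.
elim/extalg_ind: a => [x a a' Ha Ha'||S].
- rewrite wedgePl /= Ha Ha'.
  by rewrite wedgePl wedgePl.
- by rewrite wedge0l wedge0l
    wedge0l.
elim/extalg_ind: b => [x b b' Hb Hb'||T].
- rewrite wedgePl !linearP /= Hb Hb'.
  by rewrite wedgePl.
- by rewrite wedge0l !linear0 wedge0l.
elim/extalg_ind: c => [x c c' Hc Hc'||K].
- by rewrite !linearP /= Hc Hc'.
- by rewrite !linear0.
rewrite !wedge_basis.
case: (boolP [disjoint T & K]) => dTK; case: (boolP [disjoint S & T]) => dST.
- rewrite linearZ wedgeZl /= !wedge_basis.
  have -> : [disjoint S & T :|: K] = [disjoint S :|: T & K].
    by rewrite -!setI_eq0 setIUr setIUl !setU_eq0 !setI_eq0 dST dTK andbT.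
  case: ifP; last by rewrite !scaler0.
  rewrite -setI_eq0 setIUl setU_eq0 !setI_eq0 dTK andbT => dSK.
  by rewrite !scalerA ext_signUr // ext_signUl // setUA mulrCA [sg T K * _]mulrC.
- rewrite wedge0l linearZ /= wedge_basis.
  by rewrite -setI_eq0 setIUr setU_eq0 !setI_eq0 (negPf dST) scaler0.
- rewrite linear0 wedgeZl /= wedge_basis.
  by rewrite -setI_eq0 setIUl setU_eq0 !setI_eq0 (negPf dTK) andbF scaler0.
- by rewrite linear0 wedge0l.
Qed.

Lemma contr_wedge a b t : contr (wedge a b) t = contr a (contr b t).
Proof.
elim/extalg_ind: a => [x a a' Ha Ha'||S].
- rewrite wedgePl contrPl /= Ha Ha'.
  by rewrite contrPl.
- by rewrite wedge0l contr0l
    contr0l.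
elim/extalg_ind: b => [x b b' Hb Hb'||T].
- by rewrite linearP !contrPl /= Hb Hb' linearP.
- by rewrite linear0 !contr0l linear0.
elim/extalg_ind: t => [x c c' Hc Hc'||K].
- by rewrite !linearP /= Hc Hc'.
- by rewrite !linear0.
rewrite wedge_basis contr_basis.
case: (boolP (T \subset K)) => TK; last first.
  rewrite linear0; case: ifP => _; last by rewrite contr0l.
  by rewrite contrZl /= contr_basis subUset (negPf TK) andbF scaler0.
rewrite linearZ /= contr_basis subsetD andbC; case: ifP => dST /=; last first.
  by rewrite contr0l scaler0.
rewrite contrZl /= contr_basis subUset TK andbT.
case: ifP => SK; last by rewrite !scaler0.
have dTKT : [disjoint T & K :\: T].
  by rewrite -setI_eq0 setIDA setIC -setIDA setDv setI0.
have sgK : sg S K = sg S T * sg S (K :\: T).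
  by rewrite -ext_signUr // -[in LHS](setID K T) (setIidPr TK).
rewrite !scalerA ext_signUl // sgK !mulrA ext_sign_sqr mul1r mulrC.
by rewrite setUC setDDl.
Qed.

Lemma contr_e1_wedge (i j : 'I_m) b :
  contr (e [set i]) (wedge (e [set j]) b) =
  (i == j)%:R *: b - wedge (e [set j]) (contr (e [set i]) b).
Proof.
elim/extalg_ind: b => [x b b' Hb Hb'||T].
- rewrite [wedge _ (_ *: b + _)]linearP [LHS]linearP /= Hb Hb' [contr _ (x *: b + _)]linearP [wedge _ (_ *: contr _ _ + _)]linearP /=.
  by rewrite scalerBr scalerDr !scalerA opprD addrACA [x * _]mulrC.
- by rewrite !linear0 addr0.
rewrite wedge_basis contr_basis !disjoints1 !sub1set.
case: (eqVneq i j) => [<-|nij].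
  rewrite scale1r; case: (boolP (i \in T)) => iT /=.
    rewrite linear0 linearZ /= wedge_basis disjoints1 !inE eqxx /=.
    rewrite scalerA setD1K // (_ : sg _ _ = sg [set i] T); last first.
      rewrite -[in RHS](setD1K iT) ext_signUr ?disjoints1 ?inE ?eqxx //.
      by rewrite ext_sign11 ltnn mul1r.
    by rewrite ext_sign_sqr scale1r subrr.
  rewrite linear0 subr0 linearZ /= contr_basis sub1set !inE eqxx /=.
  rewrite scalerA setU1K // ext_signUr ?disjoints1 // ext_sign11 ltnn mul1r.
  by rewrite ext_sign_sqr scale1r.
rewrite scale0r sub0r.
case: (boolP (j \in T)) => jT /=.
  rewrite linear0; case: ifP => iT; last by rewrite !linear0.
  rewrite linearZ /= wedge_basis disjoints1 !inE jT eq_sym nij /=.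
  by rewrite scaler0 oppr0.
rewrite linearZ /= contr_basis sub1set !inE (negPf nij) /=.
case: (boolP (i \in T)) => iT; last by rewrite !linear0.
rewrite [wedge _ _]linearZ /= wedge_basis disjoints1 !inE (negPf jT) andbF /=.
rewrite !scalerA -scaleNr.
have -> : (j |: T) :\ i = j |: T :\ i.
  by apply/setP => k; rewrite !inE; case: (eqVneq k j) => [->|]; rewrite ?andbT ?orbF //= eq_sym nij.
congr (_ *: _).
rewrite ext_signUr ?disjoints1 // -[in sg [set j] T](setD1K iT) ext_signUr ?disjoints1 ?inE ?eqxx //.
rewrite !ext_sign11 mulrACA -exprD.
have -> : ((i < j) + (j < i))%N = 1%N by case: ltngtP nij => // /val_inj ->; rewrite eqxx.
by rewrite expr1 mulN1r mulrC.
Qed.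

Lemma contr_deg1_wedge (u v : 'I_m -> R) b :
  contr (ext_deg1 u) (wedge (ext_deg1 v) b) =
  (\sum_i u i * v i) *: b - wedge (ext_deg1 v) (contr (ext_deg1 u) b).
Proof.
have wedge_suml (I : finType) (F : I -> extalg R m) c :
    wedge (\sum_i F i) c = \sum_i wedge (F i) c.
  apply: (big_morph (fun a => wedge a c)) => [a a'|]; [exact: wedgeDl|exact: wedge0l].
have contr_suml (I : finType) (F : I -> extalg R m) c :
    contr (\sum_i F i) c = \sum_i contr (F i) c.
  apply: (big_morph (fun a => contr a c)) => [a a'|]; [exact: contrDl|exact: contr0l].
rewrite /ext_deg1 !wedge_suml contr_suml scaler_suml.
transitivity (\sum_i \sum_j (u i * v j) *:
    ((i == j)%:R *: b - wedge (e [set j]) (contr (e [set i]) b))).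
  apply: eq_bigr => i _; rewrite contrZl linear_sum /= scaler_sumr; apply: eq_bigr => j _.
  by rewrite wedgeZl [contr _ (_ *: _)]linearZ /= contr_e1_wedge scalerA.
under eq_bigr => i _ do under eq_bigr => j _ do rewrite scalerBr.
under eq_bigr => i _ do rewrite sumrB.
rewrite sumrB; congr (_ - _).
  apply: eq_bigr => i _; rewrite (bigD1 i) //= eqxx scale1r big1 ?addr0 //.
  by move=> j; rewrite eq_sym => /negPf ->; rewrite scale0r scaler0.
rewrite exchange_big /=; apply: eq_bigr => j _.
rewrite wedgeZl contr_suml linear_sum /= scaler_sumr; apply: eq_bigr => i _.
by rewrite contrZl [wedge _ (_ *: _)]linearZ /= scalerA mulrC.
Qed.

Lemma wedge_deg1_sqr (u : 'I_m -> R) : wedge (ext_deg1 u) (ext_deg1 u) = 0.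
Proof.
apply: extalgP => K; rewrite wedgeE ext_coef0.
have deg1 S : ext_deg1 u S = \sum_i u i * (S == [set i])%:R.
  by rewrite /ext_deg1 ext_coef_sum; apply: eq_bigr => i _; rewrite ext_coefZ ext_basisE.
have deg1N S : #|S| != 1%N -> ext_deg1 u S = 0.
  move=> S1; rewrite deg1 big1 // => i _; case: eqP => [E|_]; last by rewrite mulr0.
  by rewrite E cards1 in S1.
have deg11 i : ext_deg1 u [set i] = u i.
  rewrite deg1 (bigD1 i) //= eqxx mulr1 big1 ?addr0 // => j /negPf ji.
  by rewrite (inj_eq set1_inj) eq_sym ji mulr0.
case: (boolP (#|K| == 2)) => [/cards2P[i [j [nij ->]]]|K2]; last first.
  rewrite big1 // => S SK; case: (boolP (#|S| == 1%N)) => [/eqP S1|/deg1N ->].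
    rewrite [X in _ * X]deg1N ?mulr0 //; apply: contra K2 => /eqP KS1.
    by rewrite -(cardsID S K) (setIidPr SK) S1 KS1.
  by rewrite mulr0 mul0r.
have dij : [set i; j] :\: [set i] = [set j].
  by apply/setP => k; rewrite !inE; case: (eqVneq k j) => [->|]; rewrite ?orbT ?andbT ?orbF ?[j == i]eq_sym ?nij //; case: (k == i).
have dji : [set i; j] :\: [set j] = [set i].
  by apply/setP => k; rewrite !inE; case: (eqVneq k i) => [->|]; rewrite ?orbT ?andbT ?orbF ?nij //=; case: (k == j).
rewrite (bigD1 [set i]) ?subsetUl //= (bigD1 [set j]) /=; last first.
  by rewrite subsetUr (inj_eq set1_inj) eq_sym.
rewrite big1 ?addr0 => [|S /andP[/andP[SK Si] Sj]]; last first.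
  case: (boolP (#|S| == 1%N)) => [/cards1P[k Sk]|/deg1N ->]; last by rewrite mulr0 mul0r.
  by move: SK Si Sj; rewrite Sk sub1set !inE !(inj_eq set1_inj) => /orP[] /eqP ->; rewrite eqxx.
rewrite dij dji !deg11 !ext_sign11 -!mulrA [u j * u i]mulrC -mulrDl.
by case: ltngtP nij => [||/val_inj ->]; rewrite ?eqxx //= => _ _; rewrite expr0 expr1 ?subrr ?addNr mul0r.
Qed.

Lemma hcompE p a : a \in homog p -> hcomp p a = a :> extalg R m.
Proof.
move=> /homogP ha; apply: extalgP => S; rewrite {1}/ext_coef /= ffunE.
by case: ifPn => // /ha ->.
Qed.

Lemma homog_wedge p r a b :
  a \in homog p -> b \in homog r -> wedge a b \in homog (p + r).
Proof.
move=> /homogP ha /homogP hb; apply/homogP => K Kpr; rewrite wedgeE big1 // => S SK.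
case: (eqVneq #|S| p) => [Sp|/ha ->]; last by rewrite mulr0 mul0r.
rewrite [b _]hb ?mulr0 //; apply: contra Kpr => /eqP <-.
by rewrite -(cardsID S K) (setIidPr SK) Sp.
Qed.

Lemma homog_contr p r a t : (p <= r)%N ->
  a \in homog p -> t \in homog r -> contr a t \in homog (r - p).
Proof.
move=> pr /homogP ha /homogP ht; apply/homogP => K Kpr; rewrite contrE big1 // => S SK.
case: (eqVneq #|S| p) => [Sp|/ha ->]; last by rewrite mulr0 mul0r.
rewrite [t _]ht ?mulr0 //; apply: contra Kpr => /eqP <-.
move: SK; rewrite -setI_eq0 => /eqP SK.
by rewrite cardsU SK cards0 subn0 Sp addKn.
Qed.

Lemma homog_basis S : e S \in homog #|S|.
Proof.
apply/homogP => T TS; rewrite ext_basisE; case: eqP => // E.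
by rewrite E eqxx in TS.
Qed.

Lemma homog_divpow n a : divpow n a \in homog (2 * n).
Proof.
apply: rpred_sum => P /andP[/eqP Pn /forall_inP P2].
have -> : (2 * n = \sum_(S in P) 2)%N by rewrite sum_nat_const Pn mulnC.
elim/big_rec2: _ => [|S k c SP hc]; first by have := homog_basis set0; rewrite cards0.
apply: homog_wedge => //; apply: rpredZ.
by have := homog_basis S; rewrite (eqP (P2 _ SP)).
Qed.

Lemma ext_top_bij : bijective (fun a : extpow R m m => ext_top a).
Proof.
have hT (r : R) : r *: e setT \in homog m.
  by apply: rpredZ; have := homog_basis setT; rewrite cardsT card_ord.
exists (fun r => Submod (hT r)) => [a|r]; last first.
  by rewrite /ext_top ext_coefZ ext_basisE eqxx mulr1.
apply: val_inj; apply: extalgP => S; rewrite /= ext_coefZ ext_basisE.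
case: eqP => [->|/eqP ST]; first by rewrite mulr1.
rewrite mulr0; apply/esym; have /homogP := valP a; apply.
apply: contra ST => /eqP Sm.
by rewrite eqEcard subsetT cardsT card_ord Sm leqnn.
Qed.

End ExteriorTheory.
Definition vcoord (R : comNzRingType) (V : vectType R) (v : V) (i : 'I_(dim V)) : R :=
  VectorInternalTheory.v2r v 0 i.
Definition vbase (R : comNzRingType) (V : vectType R) (i : 'I_(dim V)) : V :=
  VectorInternalTheory.r2v (delta_mx 0 i).

Section ExteriorPowers.
Variables (R : comNzRingType) (V : vectType R).

(* /\^p V, in the chosen basis of V, and /\^p V^*, in the dual basis. *)
Definition extp (p : nat) : Type := extpow R (dim V) p.
HB.instance Definition _ p := GRing.Lmodule.on (extp p).
Definition extp_pow p (a : extp p) : extpow R (dim V) p := a.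
Coercion extp_pow : extp >-> extpow.
Definition dextp (p : nat) : Type := extpow R (dim V) p.
HB.instance Definition _ p := GRing.Lmodule.on (dextp p).
Definition dextp_pow p (a : dextp p) : extpow R (dim V) p := a.
Coercion dextp_pow : dextp >-> extpow.

Definition vec_ext (v : V) : extalg R (dim V) :=
  ext_deg1 (vcoord v).
Definition covec_ext (w : 'Hom(V, R^o)) : extalg R (dim V) :=
  ext_deg1 (fun i => w (vbase i)).

(* The identifications /\^1 V = V and /\^1 V^* = V^*. *)
Definition ext_vec (a : extalg R (dim V)) : V :=
  \sum_i a [set i] *: vbase i.
Definition ext_covec (a : extalg R (dim V)) : 'Hom(V, R^o) :=
  linfun (fun v : V => \sum_i a [set i] * vcoord v i : R^o).

End ExteriorPowers.
Arguments extp {R} V p.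
Arguments dextp {R} V p.

Section ExteriorPowersTheory.
Import VectorInternalTheory.
Variables (R : comNzRingType) (V : vectType R).
Implicit Types (v : V) (w : 'Hom(V, R^o)) (b : extalg R (dim V)).

Lemma vcoordP v : v = \sum_i vcoord v i *: vbase i.
Proof.
rewrite -{1}[v]v2rK [X in r2v X]row_sum_delta.
by rewrite linear_sum; apply: eq_bigr => i _; rewrite linearZ.
Qed.

Lemma covecE w v : w v = \sum_i w (vbase i) * vcoord v i.
Proof.
rewrite {1}[v]vcoordP linear_sum; apply: eq_bigr => i _.
by rewrite linearZ /= mulrC.
Qed.

Lemma ext_deg1E (u : 'I_(dim V) -> R) i : ext_deg1 u [set i] = u i.
Proof.
rewrite /ext_deg1 ext_coef_sum (bigD1 i) //= big1 ?addr0 => [|j /negPf ji].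
  by rewrite ext_coefZ ext_basisE eqxx mulr1.
by rewrite ext_coefZ ext_basisE (inj_eq set1_inj) eq_sym ji mulr0.
Qed.

Lemma contr_covec_wedge w v b :
  contr (covec_ext w) (wedge (vec_ext v) b) =
  w v *: b - wedge (vec_ext v) (contr (covec_ext w) b).
Proof. by rewrite contr_deg1_wedge -covecE. Qed.

Lemma contr_vec_wedge v w b :
  contr (vec_ext v) (wedge (covec_ext w) b) =
  w v *: b - wedge (covec_ext w) (contr (vec_ext v) b).
Proof.
rewrite contr_deg1_wedge covecE; congr (_ *: _ - _).
by apply: eq_bigr => i _; rewrite mulrC.
Qed.

Lemma vec_extK : cancel (@vec_ext R V) (@ext_vec R V).
Proof.
by move=> v; rewrite [RHS]vcoordP; apply: eq_bigr => i _; rewrite ext_deg1E.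
Qed.

Lemma covec_extK : cancel (@covec_ext R V) (@ext_covec R V).
Proof.
move=> w; apply/lfunP => v; rewrite /ext_covec.
pose f v : R^o := \sum_i covec_ext w [set i] * vcoord v i.
have fE : f =1 w by move=> u; rewrite covecE; apply: eq_bigr => i _; rewrite ext_deg1E.
rewrite -[linfun _]/(linfun f) (_ : linfun f = linfun w); last first.
  by rewrite unlock /linfun_def; congr Hom; apply/matrixP => i j; rewrite !mxE /= fE.
by rewrite lfunE.
Qed.

End ExteriorPowersTheory.

Definition im (R : comNzRingType) (A : Type) (f : A -> R^o) : R -> Prop :=
  fun r => exists y, f y = r.

Section Splitting.
Variables (R : comNzRingType) (V : vectType R).

(* R v0 is free of rank 1 and a direct summand of V. *)
Definition generates_free_summand1 (v0 : V) : Prop :=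
  (forall r : R, r *: v0 = 0 -> r = 0) /\
  exists W : submodClosed V, forall v,
    exists! rw : R * submod W, v = rw.1 *: v0 + val rw.2.

Variables (v0 : V) (w0 : 'Hom(V, R^o)) (w0v0 : w0 v0 = 1).

Definition hker : Type := submod (kerp w0).
HB.instance Definition _ := GRing.Lmodule.on hker.
Definition hker_val (v : hker) : V := submod_val v.
Coercion hker_val : hker >-> Vector.sort.

Fact proj_subproof (v : V) : v - w0 v *: v0 \in kerp w0.
Proof. by rewrite inE linearB linearZ /= w0v0 [_ *: _]mulr1 subrr. Qed.
Definition proj (v : V) : hker := Submod (proj_subproof v).

(* /\^p V' inside /\^p V, for V' = ker w0 and p = 2. *)
Definition ext2_ker (a : extp V 2) : Prop :=
  (a : extalg R (dim V)) \in
    submod_gen (fun b => exists v v' : hker, b = wedge (vec_ext v) (vec_ext v')).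

End Splitting.

(* Main.v *)
(** Write [p v] for the coefficient of [v /\ phi^(n)] and [A w = w(phi)].  The sequence
[R --p--> V^* --A--> V --p--> R] is the Buchsbaum-Eisenbud complex of [phi], and multiplication by
[p u] on it is null homotopic, the middle homotopy being [v |-> (z |-> z /\ v /\ u /\ phi^(n-1))];
this comes from contracting [v /\ u /\ phi^(n) = 0] and from [w(phi^(k+1)) = w(phi) /\ phi^(k)].
Likewise [x u] is null homotopic on the Koszul complex of [x], via [u /\ _].  A complex
[F3 -> F2 -> F1 -> F0] of free modules on which every element of an ideal of grade three is null
homotopic is exact at [F3], [F2] and [F1], so both complexes are exact there.  The theorem then
follows by diagram chasing, using [w0 (A w) = - w v0'] and [d1 (v', u) = p (v' + x u *: v0)]. *)
From HB Require Import structures.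
From mathcomp Require Import all_boot all_algebra ring.
From mathcomp Require Import boolp.
Require Import Defs.

Set Implicit Arguments.
Unset Strict Implicit.
Unset Printing Implicit Defensive.

Import GRing.Theory VectorInternalTheory.
Local Open Scope ring_scope.

(** * Free modules and regular sequences *)

Section FreeModules.
Variable R : comNzRingType.
Implicit Types M N : lmodType R.

Definition lin_of M N (f : M -> N) (f_lin : linear f) : {linear M -> N} :=
  HB.pack f (GRing.isLinear.Build R M N _ f f_lin).

Lemma isomorphic_trans M N (P : lmodType R) :
  isomorphic M N -> isomorphic N P -> isomorphic M P.
Proof.
by move=> [f bf] [g bg]; exists (g \o f : {linear M -> P}); apply: bij_comp.
Qed.

Lemma isomorphic_prod M M' N N' :
  isomorphic M N -> isomorphic M' N' -> isomorphic (M * M')%type (N * N')%type.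
Proof.
move=> [f [f' fK f'K]] [g [g' gK g'K]].
pose h (z : M * M') : N * N' := (f z.1, g z.2).
have h_lin : linear h by move=> a [u v] [u' v']; rewrite /h /= !linearP.
exists (lin_of h_lin); exists (fun z : N * N' => (f' z.1, g' z.2)) => [[u v]|[u v]].
  by rewrite /= fK gK.
by rewrite /= /h /= f'K g'K.
Qed.

Lemma free_module_iso M N : isomorphic M N -> free_module N -> free_module M.
Proof. by move=> MN [n Nn]; exists n; apply: isomorphic_trans MN Nn. Qed.

Lemma free_module_ffun M (I : finType) (f : M -> {ffun I -> R^o}) :
  linear f -> bijective f -> free_module M.
Proof.
move=> f_lin [g fK gK].
pose h (z : M) : 'rV[R]_#|I| := \row_i f z (enum_val i).
have h_lin : linear h.
  by move=> a u v; apply/rowP => i; rewrite !mxE f_lin !ffunE.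
exists #|I|, (lin_of h_lin).
pose h' (r : 'rV[R]_#|I|) : M := g [ffun i => r 0 (enum_rank i)].
apply: (@Bijective _ _ _ h') => [z|r].
  rewrite -[RHS]fK /=; congr (g _); apply/ffunP => i.
  by rewrite ffunE mxE enum_rankK.
by apply/rowP => i; rewrite mxE gK ffunE enum_valK.
Qed.

Lemma free_module_vect (V : vectType R) : free_module V.
Proof.
exists (dim V), (v2r : {linear V -> 'rV[R]_(dim V)}).
by exists r2v; [apply: v2rK|apply: r2vK].
Qed.

Lemma free_module_prod M N : free_module M -> free_module N -> free_module (M * N)%type.
Proof.
move=> [n Mn] [k Nk]; apply: free_module_iso (isomorphic_prod Mn Nk) _.
exact: free_module_vect.
Qed.

End FreeModules.

Section RegularTriples.
Variables (R : comNzRingType) (a b c : R).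

(** Weak regularity of [a, b, c] on [M], in terms of elements: nothing is asked of
    [M / (a, b, c) M], so the condition passes to every free module, the zero module included. *)
Definition regular_triple (M : lmodType R) : Prop :=
  [/\ forall m : M, a *: m = 0 -> m = 0,
      forall m m' : M, b *: m = a *: m' -> exists m1, m = a *: m1 &
      forall m m' m'' : M, c *: m = a *: m' + b *: m'' ->
        exists m1 m2, m = a *: m1 + b *: m2].

(** All three conditions can be tested coordinate by coordinate in a basis; [choice] assembles the
    coordinate witnesses into elements of [M]. *)
Lemma regular_triple_free (M : lmodType R) :
  regular_triple R^o -> free_module M -> regular_triple M.
Proof.
move=> [ra rb rc] [n [f [g fK gK]]].
have f_inj := can_inj fK.
split=> [m am|m m' bm|m m' m'' cm].
- apply: f_inj; rewrite linear0; apply/rowP => i; rewrite mxE; apply: ra.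
  by have /(congr1 (fun z => f z 0 i)) := am; rewrite linearZ linear0 !mxE.
- have bmi i : exists r : R^o, f m 0 i = a *: r.
    apply: (rb _ (f m' 0 i)).
    by have /(congr1 (fun z => f z 0 i)) := bm; rewrite !linearZ !mxE.
  have [F FE] := choice bmi.
  exists (g (\row_i F i)); apply: f_inj; apply/rowP => i.
  by rewrite linearZ gK !mxE FE.
- have cmi i : exists r : R^o * R^o, f m 0 i = a *: r.1 + b *: r.2.
    have [|r1 [r2 E]] := rc (f m 0 i) (f m' 0 i) (f m'' 0 i); last by exists (r1, r2).
    by have /(congr1 (fun z => f z 0 i)) := cm; rewrite linearD !linearZ !mxE.
  have [F FE] := choice cmi.
  exists (g (\row_i (F i).1)), (g (\row_i (F i).2)); apply: f_inj; apply/rowP => i.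
  by rewrite linearD !linearZ !gK !mxE FE.
Qed.

End RegularTriples.

Section Grade.
Variable R : comNzRingType.

Lemma submod_gen_sub (M : lmodType R) (A B : M -> Prop) :
  (forall x, A x -> B x) -> B 0 -> (forall (r : R) u v, B u -> B v -> B (r *: u + v)) ->
  forall x, x \in submod_gen A -> B x.
Proof.
move=> AB B0 Blin x /asboolP[k [f [y [Ay ->]]]].
by apply: big_rec => // i u _ Bu; apply: Blin => //; apply: AB.
Qed.

Lemma mem_ideal_gen0 (r : R) : r \in ideal_gen (fun y => y \in [::]) <-> r = 0.
Proof.
split=> [|->]; last exact: rpred0.
apply: (@submod_gen_sub R^o _ (fun y => y = 0)) => // s u v -> ->; by rewrite scaler0 addr0.
Qed.

Lemma mem_ideal_gen1 (a r : R) :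
  r \in ideal_gen (fun y => y \in [:: a]) <-> exists s, r = a * s.
Proof.
split=> [|[s ->]]; last first.
  rewrite mulrC; apply: (@rpredZ R R^o _ s a); apply: sub_submod_gen.
  by rewrite inE.
apply: (@submod_gen_sub R^o _ (fun y => exists s, y = a * s)) => [x|| s u v [u' ->] [v' ->]].
- by rewrite inE => /eqP ->; exists 1; rewrite mulr1.
- by exists 0; rewrite mulr0.
by exists (s * u' + v'); rewrite mulrDr mulrCA.
Qed.

Lemma mem_ideal_gen2 (a b r : R) :
  r \in ideal_gen (fun y => y \in [:: a; b]) <-> exists s t, r = a * s + b * t.
Proof.
split=> [|[s [t ->]]]; last first.
  rewrite mulrC [b * t]mulrC.
  apply: (@rpredD R^o); apply: (@rpredZ R R^o); apply: sub_submod_gen.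
    by rewrite inE eqxx.
  by rewrite !inE eqxx orbT.
apply: (@submod_gen_sub R^o _ (fun y => exists s t, y = a * s + b * t))
  => [x|| s u v [u1 [u2 ->]] [v1 [v2 ->]]].
- rewrite !inE => /orP[] /eqP ->; [exists 1, 0|exists 0, 1];
    by rewrite mulr1 mulr0 ?addr0 ?add0r.
- by exists 0, 0; rewrite !mulr0 addr0.
exists (s * u1 + v1), (s * u2 + v2).
by rewrite -[s *: _]/(s * _); ring.
Qed.

Lemma grade3_regular_triple (I : R -> Prop) : has_grade I 3 ->
  exists a b c, [/\ I a, I b, I c & regular_triple a b c R^o].
Proof.
move=> [_ [s [[_ reg] sI s3]] _]; case: s s3 sI reg => [|a [|b [|c []]]] // _ sI reg.
exists a, b, c; split; try by apply: sI; rewrite !inE eqxx ?orbT.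
split=> [m am|m m' bm|m m' m'' cm].
- apply/mem_ideal_gen0; apply: (reg 0 m) => //.
  by apply/mem_ideal_gen0; apply: am.
- apply/mem_ideal_gen1; apply: (reg 1%N m) => //.
  by apply/mem_ideal_gen1; exists m'; apply: bm.
apply/mem_ideal_gen2; apply: (reg 2 m) => //.
by apply/mem_ideal_gen2; exists m', m''; apply: cm.
Qed.

End Grade.

(** * Acyclicity *)

Section Acyclicity.
Variables (R : comNzRingType) (F3 F2 F1 F0 : lmodType R).
Variables (d3 : {linear F3 -> F2}) (d2 : {linear F2 -> F1}) (d1 : {linear F1 -> F0}).

(** The homotopy identity is imposed at [F3], [F2] and [F1], the three places where exactness is to
    be derived. *)
Definition null_homotopic (y : R) : Prop :=
  exists (h2 : {linear F2 -> F3}) (h1 : {linear F1 -> F2}) (h0 : {linear F0 -> F1}),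
  [/\ forall z, h2 (d3 z) = y *: z,
      forall z, h1 (d2 z) + d3 (h2 z) = y *: z &
      forall z, h0 (d1 z) + d2 (h1 z) = y *: z].

Variables (I : R -> Prop) (I_grade : has_grade I 3).
Hypothesis I_homotopy : forall y, I y -> null_homotopic y.
Hypotheses (F3_free : free_module F3) (F2_free : free_module F2) (F1_free : free_module F1).

Hypothesis d2d3 : forall z, d2 (d3 z) = 0.

Lemma null_homotopic_inj z : d3 z = 0 -> z = 0.
Proof.
have [a [b [c [Ia Ib Ic reg]]]] := grade3_regular_triple I_grade.
have [ra _ _] := regular_triple_free reg F3_free.
have [h2 [h1 [h0 [E3 _ _]]]] := I_homotopy Ia.
by move=> dz; apply: ra; rewrite -E3 dz linear0.
Qed.

(** The homotopy for [a] makes [a *: z] a boundary, and the one for [b] shows that its preimage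
    [h2 z] is divisible by [a]. Cancelling [a] makes [z] itself a boundary. *)
Lemma null_homotopic_exact2 z : d2 z = 0 -> exists y, d3 y = z.
Proof.
have [a [b [c [Ia Ib Ic reg]]]] := grade3_regular_triple I_grade.
have [ra _ _] := regular_triple_free reg F2_free.
have [_ rb _] := regular_triple_free reg F3_free.
have [h2 [h1 [h0 [_ Ea _]]]] := I_homotopy Ia.
have [k2 [k1 [k0 [Eb _ _]]]] := I_homotopy Ib.
move=> dz; have az : d3 (h2 z) = a *: z by rewrite -Ea dz linear0 add0r.
have [|y yE] := rb (h2 z) (k2 z); first by rewrite -Eb az linearZ.
exists y; apply/eqP; rewrite -subr_eq0; apply/eqP; apply: ra.
by rewrite scalerBr -az yE linearZ subrr.
Qed.

(** As in the previous degree, but the preimage [h1 z] of [a *: z] is divisible by [a] only after a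
    correction by a boundary [d3 g2], which the third element [c] provides. *)
Lemma null_homotopic_exact1 z : d1 z = 0 -> exists y, d2 y = z.
Proof.
have [a [b [c [Ia Ib Ic reg]]]] := grade3_regular_triple I_grade.
have [ra _ _] := regular_triple_free reg F1_free.
have [_ rb _] := regular_triple_free reg F2_free.
have [_ _ rc] := regular_triple_free reg F3_free.
have [h2 [h1 [h0 [_ _ Ea]]]] := I_homotopy Ia.
have [k2 [k1 [k0 [_ Eb _]]]] := I_homotopy Ib.
have [l2 [l1 [l0 [Ec _ _]]]] := I_homotopy Ic.
move=> dz; have az : d2 (h1 z) = a *: z by rewrite -Ea dz linear0 add0r.
have by1 : d3 (k2 (h1 z)) = b *: h1 z - a *: k1 z.
  by rewrite -Eb az linearZ /= addrAC subrr add0r.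
(* Applying [l2] to [by1] gives [c *: k2 (h1 z) = b *: l2 (h1 z) - a *: l2 (k1 z)], so regularity of
   [c] modulo [(a, b)] splits [k2 (h1 z)]. *)
have [|g1 [g2 gE]] := rc (k2 (h1 z)) (- l2 (k1 z)) (l2 (h1 z)).
  by rewrite -Ec by1 linearB !linearZ /= scalerN addrC.
(* Substituting the splitting into [by1] gives [b *: (h1 z - d3 g2) = a *: (k1 z + d3 g1)]. *)
have [|y yE] := rb (h1 z - d3 g2) (k1 z + d3 g1).
  move: by1; rewrite gE linearD !linearZ /= => E.
  by apply/eqP; rewrite scalerBr subr_eq scalerDr -addrA E addrC scalerN subrK.
exists y; apply/eqP; rewrite -subr_eq0; apply/eqP; apply: ra.
by rewrite scalerBr -az -linearZ -yE linearB d2d3 subr0 subrr.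
Qed.

End Acyclicity.

(** * Exterior algebra and divided powers *)

Section ExteriorAlgebra.
Variables (R : comNzRingType) (m : nat).
Implicit Types (S T : {set 'I_m}) (a b c t : extalg R m) (u v w : 'I_m -> R).
Local Notation sg := (@ext_sign R m).
Local Notation e := (@ext_basis R m).

Lemma wedge_suml (I : Type) (r : seq I) (P : pred I) (F : I -> extalg R m) c :
  wedge (\sum_(i <- r | P i) F i) c = \sum_(i <- r | P i) wedge (F i) c.
Proof.
by apply: (big_morph (fun a => wedge a c)) => [a a'|]; [apply: wedgeDl|apply: wedge0l].
Qed.

Lemma contr_suml (I : Type) (r : seq I) (P : pred I) (F : I -> extalg R m) c :
  contr (\sum_(i <- r | P i) F i) c = \sum_(i <- r | P i) contr (F i) c.
Proof.
by apply: (big_morph (fun a => contr a c)) => [a a'|]; [apply: contrDl|apply: contr0l].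
Qed.

Lemma wedgeBl a b c : wedge (a - b) c = wedge a c - wedge b c.
Proof. by rewrite wedgeDl -scaleN1r wedgeZl scaleN1r. Qed.

(** By disjointness, each pair in [S] times [T] is an inversion for exactly one of the two
    orders. *)
Lemma ext_signC S T : [disjoint S & T] -> sg S T * sg T S = (-1) ^+ (#|S| * #|T|).
Proof.
move=> dST; rewrite /ext_sign -exprD; congr (_ ^+ _).
rewrite [X in (_ + X)%N]exchange_big -big_split /= -sum_nat_const.
apply: eq_bigr => i iS; rewrite -big_split /= -sum1_card.
apply: eq_bigr => j jT; case: ltngtP => // /val_inj E.
by move/disjointFr: dST => /(_ j); rewrite {1}E iS jT => /(_ isT).
Qed.

Lemma wedge_basisC S b : ~~ odd #|S| -> wedge (e S) b = wedge b (e S).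
Proof.
move=> evS; elim/extalg_ind: b => [x b b' Hb Hb'||T].
- by rewrite linearP /= Hb Hb' wedgePl.
- by rewrite linear0 wedge0l.
rewrite !wedge_basis disjoint_sym; case: ifP => // dST; rewrite setUC; congr (_ *: _).
rewrite -[RHS]mul1r -(ext_sign_sqr R S T) -mulrA ext_signC 1?disjoint_sym //.
by rewrite -signr_odd oddM (negPf evS) mulr1.
Qed.

Lemma ext_deg1_basis i : ext_deg1 (fun j => (j == i)%:R) = e [set i].
Proof.
rewrite /ext_deg1 (bigD1 i) //= eqxx scale1r big1 ?addr0 // => j /negPf ->.
by rewrite scale0r.
Qed.

Lemma homog_deg1 u : ext_deg1 u \in homog 1.
Proof.
by apply: rpred_sum => i _; apply: rpredZ; have := homog_basis R [set i]; rewrite cards1.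
Qed.

Lemma homog_large p a : (m < p)%N -> a \in homog p -> a = 0.
Proof.
move=> mp /homogP ha; apply: extalgP => S; rewrite ext_coef0 ha //.
by rewrite neq_ltn (leq_ltn_trans (max_card _)) // card_ord.
Qed.

(** The degree is a variable of its own because [dim V] is only propositionally equal to
    [(2 * n).+1]. *)
Lemma homog_topE p a : m = p -> a \in homog p -> a = ext_top a *: e setT.
Proof.
move=> <- /homogP ha; apply: extalgP => S; rewrite ext_coefZ ext_basisE.
case: eqP => [->|/eqP ST]; first by rewrite mulr1.
rewrite mulr0 ha //; apply: contra ST => /eqP Sm.
by rewrite eqEcard subsetT cardsT card_ord Sm leqnn.
Qed.

Lemma ext_top_inj p a b : m = p -> a \in homog p -> b \in homog p ->
  ext_top a = ext_top b -> a = b.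
Proof. by move=> mp ha hb E; rewrite (homog_topE mp ha) (homog_topE mp hb) E. Qed.

(** Polarisation: expand the square of [u + v], which vanishes, as do those of [u] and [v]. *)
Lemma wedge_deg1C u v : wedge (ext_deg1 u) (ext_deg1 v) = - wedge (ext_deg1 v) (ext_deg1 u).
Proof.
have := wedge_deg1_sqr (fun i => u i + v i); set uv := ext_deg1 _.
have -> : uv = ext_deg1 u + ext_deg1 v.
  by rewrite /uv /ext_deg1 -big_split /=; apply: eq_bigr => i _; rewrite scalerDl.
rewrite linearD /= !wedgeDl !wedge_deg1_sqr add0r addr0 addrC => /eqP.
by rewrite addr_eq0 => /eqP.
Qed.

Lemma wedge_deg1CA u v b :
  wedge (ext_deg1 u) (wedge (ext_deg1 v) b) = - wedge (ext_deg1 v) (wedge (ext_deg1 u) b).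
Proof. by rewrite !wedgeA wedge_deg1C -scaleN1r wedgeZl scaleN1r. Qed.

Lemma wedge_deg1K u b : wedge (ext_deg1 u) (wedge (ext_deg1 u) b) = 0.
Proof. by rewrite wedgeA wedge_deg1_sqr wedge0l. Qed.

Lemma contr_deg1K u b : contr (ext_deg1 u) (contr (ext_deg1 u) b) = 0.
Proof. by rewrite -contr_wedge wedge_deg1_sqr contr0l. Qed.

Lemma wedge1r a : wedge a (ext1 R m) = a.
Proof. by rewrite -wedge_basisC ?cards0 // wedge1l. Qed.

Lemma contr_deg1_ext1 u : contr (ext_deg1 u) (ext1 R m) = 0.
Proof.
rewrite /ext_deg1 contr_suml big1 // => i _.
by rewrite contrZl contr_basis sub1set inE scaler0.
Qed.

(** * Elementary symmetric functions in the exterior algebra *)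

Section ElementarySymmetric.
Variables (T : finType) (t : T -> extalg R m).

(* Recursing on a list keeps the factors in the order in which [divpow] multiplies them. *)
Fixpoint ext_elsym (k : nat) (r : seq T) : extalg R m :=
  match k, r with
  | 0, _ => ext1 R m
  | k'.+1, s :: r' => ext_elsym k r' + wedge (t s) (ext_elsym k' r')
  | _.+1, [::] => 0
  end.

(** Subsets of [s :: r] are split according to whether they contain [s]. This turns the sum over
    subsets defining [divpow] into a recursion on which a derivation can be computed. *)
Lemma ext_elsymE k (r : seq T) : uniq r ->
  \sum_(P : {set T} | (#|P| == k) && (P \subset r)) \big[@wedge R m/ext1 R m]_(s <- r | s \in P) t s
  = ext_elsym k r.
Proof.
have P0 (r' : seq T) (P : {set T}) : (#|P| == 0) && (P \subset r') = (P == set0).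
  by rewrite cards_eq0; case: eqP => //= ->; apply/subsetP => x; rewrite inE.
elim: r k => [|s r IHr] [|k] //= ur.
- by rewrite (big_pred1 set0) ?big_nil.
- rewrite big1 // => P /andP[Pk /subsetP Psub].
  have P00 : P = set0 by apply/setP => x; rewrite inE; apply/negP => /Psub.
  by rewrite P00 cards0 in Pk.
- rewrite (big_pred1 set0) => [|P]; last exact: P0.
  by rewrite big_pred0 // => x; rewrite inE.
case/andP: ur => sr ur; rewrite (bigID (fun P : {set T} => s \in P)) /= addrC.
congr (_ + _).
  rewrite -IHr //; apply: eq_big => [P|P /andP[_ /negPf sP]]; last by rewrite big_cons sP.
  rewrite -andbA; congr (_ && _); apply/andP/idP => [[/subsetP Psr sP]|/subsetP Pr].
    apply/subsetP => x xP; have := Psr x xP; rewrite inE => /orP[/eqP xs|//].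
    by rewrite -xs xP in sP.
  split; first by apply/subsetP => x /Pr; rewrite inE orbC => ->.
  by apply: contra sr => /Pr.
rewrite -IHr // linear_sum /=.
(* The sets containing [s] are the [s |: Q] with [s] outside [Q]; sets [Q] that already contain [s]
   are excluded on both sides. *)
rewrite (reindex_onto (fun Q : {set T} => s |: Q) (fun P => P :\ s)) /=; last first.
  by move=> P /andP[_ sP]; rewrite setD1K.
apply: eq_big => [Q|Q /andP[_ /eqP QE]].
  rewrite setU11 andbT; case: (boolP (s \in Q)) => sQ.
    have -> : (s |: Q) :\ s == Q = false.
      by apply/eqP => /setP /(_ s); rewrite !inE eqxx sQ.
    rewrite andbF; apply/esym/negbTE; rewrite negb_and; apply/orP; right.
    by apply: contra sr => /subsetP; apply.
  rewrite cardsU1 sQ /= add1n eqSS setU1K // eqxx andbT; congr (_ && _).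
  apply/subsetP/subsetP => Qr x xQ.
    have := Qr x; rewrite !inE xQ orbT => /(_ isT) /orP[/eqP xs|//].
    by rewrite -xs xQ in sQ.
  by move: xQ; rewrite !inE => /orP[->//|/Qr ->]; rewrite orbT.
rewrite big_cons setU11; congr wedge; rewrite [LHS]big_seq_cond [RHS]big_seq_cond.
apply: eq_bigl => x; rewrite !inE; case: eqP => [->|//]; by rewrite (negPf sr).
Qed.

Variables (w : 'I_m -> R).
Local Notation D := (contr (ext_deg1 w)).
Hypothesis tC : forall s b, wedge (t s) b = wedge b (t s).
Hypothesis tD : forall s b, D (wedge (t s) b) = wedge (D (t s)) b + wedge (t s) (D b).
Hypothesis tDt : forall s, wedge (D (t s)) (t s) = 0.

(** Induction by the Leibniz rule [tD]. When [s] is added, the one unwanted product [D (t s) /\ t s]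
    vanishes by [tDt], and centrality [tC] puts the remaining factors in order. *)
Lemma contr_ext_elsym k (r : seq T) :
  D (ext_elsym k.+1 r) = wedge (\sum_(s <- r) D (t s)) (ext_elsym k r).
Proof.
elim: r k => [|s r IHr] k; first by rewrite big_nil /= linear0 wedge0l.
rewrite big_cons [ext_elsym k.+1 _]/= linearD /= tD IHr wedgeDl.
case: k => [|k] /=.
  have -> : ext_elsym 0 r = ext1 R m by case: (r).
  by rewrite contr_deg1_ext1 linear0 addr0 addrC.
rewrite IHr !linearD /= !(wedgeA _ (t s)) tDt wedge0l addr0.
by rewrite wedgeA tC addrCA.
Qed.

End ElementarySymmetric.

(** Up to sign [e S] is a product [u /\ v] of two vectors, whose contraction is [w(u) v - w(v) u].
    This has even degree behaviour under Leibniz, and its product with [u /\ v] repeats a vector. *)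
Lemma contr_deg1_wedge_pair w S b : #|S| = 2 ->
  contr (ext_deg1 w) (wedge (e S) b) =
    wedge (contr (ext_deg1 w) (e S)) b + wedge (e S) (contr (ext_deg1 w) b) /\
  wedge (contr (ext_deg1 w) (e S)) (e S) = 0.
Proof.
move=> /eqP /cards2P[i [j [ij ->]]].
have eij : e [set i; j] = sg [set i] [set j] *:
    wedge (ext_deg1 (fun k => (k == i)%:R)) (ext_deg1 (fun k => (k == j)%:R)).
  rewrite !ext_deg1_basis wedge_basis disjoints1 inE ij scalerA.
  by rewrite ext_sign_sqr scale1r.
rewrite eij; set s := sg _ _.
set u := ext_deg1 (fun k => (k == i)%:R); set v := ext_deg1 (fun k => (k == j)%:R).
have E c : contr (ext_deg1 w) (wedge u (wedge v c)) =
  (\sum_k w k * (k == i)%:R) *: wedge v c - (\sum_k w k * (k == j)%:R) *: wedge u c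
  + wedge u (wedge v (contr (ext_deg1 w) c)).
  by rewrite !contr_deg1_wedge linearB /= linearZ /= opprB addrA addrAC.
have E1 := E (ext1 R m); rewrite !wedge1r contr_deg1_ext1 !linear0 addr0 in E1.
split.
  rewrite wedgeZl -wedgeA [LHS]linearZ /= E [contr _ (s *: _)]linearZ /= E1 !wedgeZl.
  by rewrite wedgeBl !wedgeZl -scalerDr wedgeA.
rewrite [contr _ _]linearZ /= E1 !wedgeZl linearZ /= wedgeBl !wedgeZl.
by rewrite wedge_deg1K (wedge_deg1C (fun k => (k == i)%:R)) linearN /=
  wedge_deg1K oppr0 !scaler0 subr0 !scaler0.
Qed.

(** The divided power is the [n]-th elementary symmetric function of the degree two terms of [a], so
    the identity holds without dividing by factorials. *)
Lemma contr_divpow w n a : a \in homog 2 ->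
  contr (ext_deg1 w) (divpow n.+1 a) = wedge (contr (ext_deg1 w) a) (divpow n a).
Proof.
(* Setting [t S] to zero off the pairs lets the hypotheses on [t] hold for every [S]. *)
move=> /homogP a2; pose t S := if #|S| == 2 then a S *: e S else 0.
pose r : seq {set 'I_m} := [seq S <- index_enum _ | #|S : {set 'I_m}| == 2].
have divpowE k : divpow k a = ext_elsym t k r.
  rewrite -ext_elsymE ?filter_uniq ?index_enum_uniq //.
  apply: eq_big => [P|P /andP[_ /forall_inP P2]].
    congr (_ && _); apply/forall_inP/subsetP => P2 S SP.
      by rewrite mem_filter P2 ?mem_index_enum.
    by have := P2 S SP; rewrite mem_filter => /andP[].
  rewrite big_filter_cond; apply: eq_big => [S|S SP]; last by rewrite /t P2.
  by case: (boolP (S \in P)) => SP; rewrite ?andbF ?andbT ?P2.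
rewrite !divpowE contr_ext_elsym.
(* The terms [t S] add up to [a], which lives on sets of two elements. *)
- congr wedge; rewrite -linear_sum /=; congr (contr _ _); rewrite big_filter.
  rewrite [RHS]extalg_sum [RHS](bigID (fun S : {set 'I_m} => #|S| == 2)) /=.
  rewrite [X in _ + X]big1 ?addr0 => [|S /a2 ->]; last by rewrite scale0r.
  by apply: eq_bigr => S S2; rewrite /t S2.
- move=> S b; rewrite /t; case: eqP => [S2|_]; last by rewrite linear0 wedge0l.
  by rewrite wedgeZl linearZ /= wedge_basisC // S2.
- move=> S b; rewrite /t; case: eqP => [S2|_]; last by rewrite !(linear0, wedge0l) addr0.
  have [SD _] := contr_deg1_wedge_pair w b S2.
  by rewrite wedgeZl [LHS]linearZ /= SD [contr _ (_ *: _)]linearZ /= !wedgeZl scalerDr.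
move=> S; rewrite /t; case: eqP => [S2|_]; last by rewrite linear0.
rewrite [contr _ _]linearZ /= wedgeZl [wedge _ _]linearZ /=.
by have [_ ->] := contr_deg1_wedge_pair w 0 S2; rewrite !scaler0.
Qed.

End ExteriorAlgebra.

(** * Linearity of components and freeness of the exterior powers *)

Section ExteriorLinear.
Variables (R : comNzRingType) (m : nat).

Lemma ext_top_linear : linear (@ext_top R m : _ -> R^o).
Proof. by move=> r a b; rewrite /ext_top ext_coefD ext_coefZ. Qed.

Lemma ext_topN (a : extalg R m) : ext_top (- a) = - ext_top a.
Proof. by rewrite -scaleN1r /ext_top ext_coefZ mulN1r. Qed.

Lemma hcomp_coef p (a : extalg R m) S : hcomp p a S = if #|S| == p then a S else 0.
Proof. by rewrite {1}/ext_coef /= ffunE. Qed.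

Lemma hcomp_linear p : linear (@hcomp R m p).
Proof.
move=> r a b; apply: val_inj; rewrite linearP; apply: extalgP => S.
rewrite ext_coefD ext_coefZ -!/(extpow_val _) !hcomp_coef.
by case: ifP; rewrite ?ext_coefD ?ext_coefZ ?mulr0 ?addr0.
Qed.

Lemma extpow_val_linear p : linear (@extpow_val R m p : extpow R m p -> extalg R m).
Proof. by move=> r a b; rewrite -[LHS]/(\val (r *: a + b)) linearP. Qed.

Lemma free_extpow p : free_module (extpow R m p).
Proof.
pose I : finType := {S : {set 'I_m} | #|S| == p}.
pose f (a : extpow R m p) : {ffun I -> R^o} := [ffun s : I => (a : extalg R m) (val s)].
pose g (r : {ffun I -> R^o}) : extpow R m p :=
  hcomp p [ffun S => if insub S is Some s then r s else 0].
apply: (@free_module_ffun _ _ I f)=> [r a b|].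
  by apply/ffunP => s; rewrite !ffunE extpow_val_linear ext_coefD ext_coefZ.
exists g => [a|r].
  apply: val_inj; apply: extalgP => S; rewrite [LHS]ffunE.
  case: ifP => [Sp|/negbT Sp]; last by rewrite (homogP _ _ (valP a)).
  by rewrite /ext_coef ffunE insubT /= ffunE.
apply/ffunP => s; rewrite ffunE /g [LHS]ffunE (valP s) /ext_coef ffunE.
by rewrite valK.
Qed.

End ExteriorLinear.

(** * Vectors and covectors as elements of degree one *)

Section VectorExterior.
Variables (R : comNzRingType) (V : vectType R).
Implicit Types (u v z : V) (w : 'Hom(V, R^o)) (a b : extalg R (dim V)).

Lemma vcoord_linear i : linear (fun v => vcoord v i : R^o).
Proof. by move=> r u v; rewrite /vcoord linearP !mxE. Qed.

Lemma vcoord_base i j : vcoord (vbase i : V) j = (j == i)%:R.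
Proof. by rewrite /vcoord /vbase r2vK mxE. Qed.

Lemma vec_ext_linear : linear (@vec_ext R V).
Proof.
move=> r u v; rewrite /vec_ext /ext_deg1 scaler_sumr -big_split /=.
by apply: eq_bigr => i _; rewrite vcoord_linear scalerDl scalerA.
Qed.

Lemma vec_ext_base i : vec_ext (vbase i : V) = ext_basis R [set i].
Proof.
rewrite -ext_deg1_basis /vec_ext /ext_deg1.
by apply: eq_bigr => j _; rewrite vcoord_base.
Qed.

Lemma covec_ext_linear : linear (@covec_ext R V).
Proof.
move=> r w w'; rewrite /covec_ext /ext_deg1 scaler_sumr -big_split /=.
by apply: eq_bigr => i _; rewrite !lfunE /= scalerDl scalerA lfunE.
Qed.

Lemma ext_vec_linear : linear (@ext_vec R V).
Proof.
move=> r a b; rewrite /ext_vec scaler_sumr -big_split /=.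
by apply: eq_bigr => i _; rewrite ext_coefD ext_coefZ scalerDl scalerA.
Qed.

Lemma homog_vec_ext v : vec_ext v \in homog 1.
Proof. exact: homog_deg1. Qed.

Lemma ext_vecK a : a \in homog 1 -> vec_ext (ext_vec a) = a.
Proof.
move=> ha; pose f v : extalg R (dim V) := vec_ext v.
rewrite /ext_vec -[LHS]/(lin_of vec_ext_linear _) linear_sum [RHS]extalg_sum.
rewrite [RHS](bigID (fun S => S \in [set [set i] | i : 'I_(dim V)])) /=.
rewrite [X in _ + X]big1 ?addr0 => [|S nS]; last first.
  move/homogP: ha => -> //; first by rewrite scale0r.
  by apply: contra nS => /cards1P[i ->]; apply: imset_f.
rewrite big_imset /=; last by move=> i j _ _ /set1_inj.
by apply: eq_bigr => i _; rewrite -[LHS]/(lin_of vec_ext_linear _) linearZ /= vec_ext_base.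
Qed.

Lemma ext_covecE a v : ext_covec a v = \sum_i a [set i] * vcoord v i.
Proof.
pose f v : R^o := \sum_i a [set i] * vcoord v i.
have f_lin : linear f.
  move=> r u u'; rewrite /f scaler_sumr -big_split /=.
  by apply: eq_bigr => i _; rewrite vcoord_linear mulrDr mulrCA.
by rewrite /ext_covec -[fun _ => _]/(lin_of f_lin : V -> R^o) lfunE.
Qed.

(** This is how a linear form given by a formula becomes an element of ['Hom(V, R^o)]. *)
Lemma ext_covec_deg1E (f : {linear V -> R^o}) v :
  ext_covec (ext_deg1 (fun i => f (vbase i))) v = f v.
Proof.
rewrite ext_covecE [v in RHS]vcoordP linear_sum; apply: eq_bigr => i _.
by rewrite linearZ /= ext_deg1E mulrC.
Qed.

(** The coordinate functions are covectors. *)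
Lemma covec_separates u v : (forall w, w u = w v) -> u = v.
Proof.
move=> uv; rewrite (vcoordP u) (vcoordP v); apply: eq_bigr => i _; congr (_ *: _).
pose f := lin_of (vcoord_linear i).
by have := uv (ext_covec (ext_deg1 (fun i => f (vbase i)))); rewrite !ext_covec_deg1E.
Qed.

Lemma contr_covec_deg1 w a : a \in homog 1 -> contr (covec_ext w) a = w (ext_vec a) *: ext1 R _.
Proof.
move=> /ext_vecK {1}<-; rewrite -[vec_ext _]wedge1r contr_covec_wedge.
by rewrite contr_deg1_ext1 linear0 subr0.
Qed.

Lemma contr_covecK w a : contr (covec_ext w) (contr (covec_ext w) a) = 0.
Proof. exact: contr_deg1K. Qed.

(** Only the full set contributes. With [m = dim V] the sign is [(-1)^(m (m - 1) / 2)], forced by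
    the contraction convention; being its own inverse, it can be absorbed later. *)
Lemma ext_pair_top b t : t \in homog (dim V) ->
  ext_pair b t = ext_sign R [set: 'I_(dim V)] setT * ext_top b * ext_top t.
Proof.
move=> /homogP ht; rewrite /ext_pair contrE (bigD1 setT) /=; last first.
  by rewrite disjoint_sym -setI_eq0 set0I.
rewrite setU0 big1 ?addr0 // => S /andP[_ ST]; rewrite setU0 ht ?mulr0 //.
by apply: contra ST => /eqP Sm; rewrite eqEcard subsetT cardsT card_ord Sm leqnn.
Qed.

(** This is [(v /\ a)(t) = v(a(t))], where [a(t)] has degree one, so that singletons alone
    contribute to both sides. *)
Lemma ext_covec_contr p a t v : (p.+1 = dim V)%N -> a \in homog p -> t \in homog (dim V) ->
  ext_covec (contr a t) v = ext_pair (wedge (vec_ext v) a) t.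
Proof.
move=> pV ha ht; rewrite /ext_pair contr_wedge.
have /homogP h1 : contr a t \in homog 1.
  have pV1 : (dim V - p = 1)%N by rewrite -pV subSnn.
  by rewrite -pV1; apply: homog_contr => //; rewrite -pV leqnSn.
rewrite ext_covecE contrE /= [RHS](bigID (fun S => S \in [set [set i] | i : 'I_(dim V)])) /=.
rewrite [X in _ = _ + X]big1 ?addr0 => [|S /andP[_ nS]]; last first.
  rewrite setU0 h1 ?mulr0 //; apply: contra nS => /cards1P[i ->]; exact: imset_f.
rewrite (eq_bigl (fun S => S \in [set [set i] | i : 'I_(dim V)])) => [|S]; last first.
  by rewrite disjoint_sym -setI_eq0 set0I eqxx.
rewrite big_imset /=; last by move=> i j _ _ /set1_inj.
apply: eq_bigr => i _; rewrite setU0 ext_deg1E.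
by rewrite ext_sign11 ltnn mul1r mulrC.
Qed.

End VectorExterior.

Section ExtpCoercion.
Variables (R : comNzRingType) (V : vectType R) (p : nat).
Implicit Types a b : extp V p.

Lemma extp_inj a b : a = b :> extalg R (dim V) -> a = b.
Proof. exact: val_inj. Qed.

Lemma extp0 : (0 : extp V p) = 0 :> extalg R (dim V).
Proof. by []. Qed.

Lemma extpD a b :
  (a + b : extp V p) = (a : extalg R (dim V)) + (b : extalg R (dim V)) :> extalg R (dim V).
Proof.
by have := extpow_val_linear 1 (a : extpow R (dim V) p) (b : extpow R (dim V) p); rewrite !scale1r.
Qed.

Lemma extpZ (r : R) a : (r *: a : extp V p) = r *: (a : extalg R (dim V)) :> extalg R (dim V).
Proof.
have := extpow_val_linear r (a : extpow R (dim V) p) 0; rewrite addr0 => E.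
by rewrite [LHS]E -[RHS]addr0.
Qed.

Lemma extp_homog a : (a : extalg R (dim V)) \in homog p.
Proof. exact: (valP (a : extpow R (dim V) p)). Qed.

End ExtpCoercion.

(** * The Koszul complex *)

Section Koszul.
Variables (R : comNzRingType) (U : vectType R) (x : 'Hom(U, R^o)).
Hypotheses (dimU : dim U = 3%N) (x_grade : has_grade (im x) 3).

Lemma koszul_diff_linear i :
  linear (fun a : extp U i.+1 => hcomp i (contr (covec_ext x) a) : extp U i).
Proof. by move=> r a b; rewrite /= [contr _ _]linearP /= hcomp_linear. Qed.

Lemma koszul_homotopy_linear u i :
  linear (fun a : extp U i => hcomp i.+1 (wedge (vec_ext u) a) : extp U i.+1).
Proof. by move=> r a b; rewrite /= [wedge _ _]linearP /= hcomp_linear. Qed.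

Lemma koszul_diffE i (a : extp U i.+1) :
  hcomp i (contr (covec_ext x) a) = contr (covec_ext x) a :> extalg _ _.
Proof.
apply: hcompE; have := homog_contr (_ : 1 <= i.+1)%N (homog_deg1 _) (valP a).
by rewrite subn1; apply.
Qed.

Lemma koszul_homotopyE u i (a : extp U i) :
  hcomp i.+1 (wedge (vec_ext u) a) = wedge (vec_ext u) a :> extalg _ _.
Proof. by apply: hcompE; have := homog_wedge (homog_vec_ext u) (valP a). Qed.

Let d i := lin_of (@koszul_diff_linear i).

Let dE i (z : extp U i.+1) : (d i z : extp U i) = contr (covec_ext x) z :> extalg _ _.
Proof. exact: koszul_diffE. Qed.

Lemma koszul_null_homotopic y : im x y -> null_homotopic (d 2) (d 1) (d 0) y.
Proof.
move=> [u <-]; pose h i := lin_of (@koszul_homotopy_linear u i).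
have hE i (z : extp U i) : (h i z : extp U i.+1) = wedge (vec_ext u) z :> extalg _ _.
  exact: koszul_homotopyE.
exists (h 2), (h 1), (h 0); split=> z; apply: extp_inj; rewrite ?extpD extpZ !(dE, hE).
- have := contr_covec_wedge x u (z : extp U 3).
  (* In top degree the other half of the homotopy vanishes, [u /\ z] having degree 4. *)
  rewrite [wedge _ (z : extp U 3)](_ : _ = 0) ?linear0; last first.
    apply: (@homog_large _ _ 4); first by rewrite dimU.
    exact: homog_wedge (homog_vec_ext u) (extp_homog (z : extp U 3)).
  by move=> /esym/eqP; rewrite subr_eq0 => /eqP <-.
- by rewrite contr_covec_wedge addrC subrK.
by rewrite contr_covec_wedge addrC subrK.
Qed.

Lemma koszul_diffK i z : d i (d i.+1 z) = 0.
Proof. by apply: extp_inj; rewrite extp0 !dE contr_covecK. Qed.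

Lemma koszul_inj3 (z : extp U 3) : hcomp 2 (contr (covec_ext x) z) = 0 -> z = 0.
Proof.
exact: (null_homotopic_inj (d3 := d 2) x_grade koszul_null_homotopic (free_extpow _ _ _)).
Qed.

Lemma koszul_exact2 (z : extp U 2) : contr (covec_ext x) z = 0 ->
  exists y : extp U 3, hcomp 2 (contr (covec_ext x) y) = z.
Proof.
move=> xz; apply: (null_homotopic_exact2 (d3 := d 2) x_grade koszul_null_homotopic
  (free_extpow _ _ _) (free_extpow _ _ _)).
by apply: extp_inj; rewrite extp0 dE.
Qed.

Lemma koszul_exact1 (u : U) : x u = 0 ->
  exists y : extp U 2, ext_vec (contr (covec_ext x) y) = u.
Proof.
move=> xu.
(* The vector [u] is viewed in the first exterior power, where its Koszul differential is [x u]
   times the unit. *)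
have [||y yE] := null_homotopic_exact1 (d3 := d 2) x_grade koszul_null_homotopic
  (free_extpow _ _ _) (free_extpow _ _ _) (free_extpow _ _ _) _ (z := hcomp 1 (vec_ext u)).
- exact: koszul_diffK.
- apply: extp_inj; rewrite extp0 dE hcompE ?homog_vec_ext //.
  by rewrite contr_covec_deg1 ?homog_vec_ext // vec_extK xu scale0r.
exists y; have := dE y; rewrite yE => <-; rewrite hcompE ?homog_vec_ext //.
exact: vec_extK.
Qed.

End Koszul.

(** * The Buchsbaum-Eisenbud complex *)

Section Pfaffians.
Variables (R : comNzRingType) (V : vectType R) (n : nat) (phi : extalg R (dim V)).
Hypotheses (n_gt0 : (0 < n)%N) (dimV : dim V = (2 * n).+1) (phi2 : phi \in homog 2).
Implicit Types (u v z : V) (w : 'Hom(V, R^o)).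

Local Notation phin := (divpow n phi).
Local Notation psi := (divpow n.-1 phi).

(** On basis vectors these are, up to sign, the Pfaffians of order [2n]; [pfaff] and [skew] are the
    maps [p] and [A] of the overview. *)
Definition pfaff v : R^o := ext_top (wedge (vec_ext v) phin).
Definition skew w : V := ext_vec (contr (covec_ext w) phi).

Let contr_phi_homog w : contr (covec_ext w) phi \in homog 1.
Proof. by apply: (@homog_contr _ _ 1 2) => //; apply: homog_deg1. Qed.

Lemma vec_ext_skew w : vec_ext (skew w) = contr (covec_ext w) phi.
Proof. exact: ext_vecK. Qed.

Lemma pfaff_linear : linear pfaff.
Proof. by move=> r u v; rewrite /pfaff vec_ext_linear wedgePl ext_top_linear. Qed.

Lemma skew_linear : linear skew.
Proof. by move=> r w w'; rewrite /skew covec_ext_linear contrPl ext_vec_linear. Qed.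

(** Both sides come from contracting [phi] with [w /\ w'], in one order or the other. *)
Lemma skew_anti w w' : w (skew w') = - w' (skew w).
Proof.
have E w1 w2 : w1 (skew w2) = contr (wedge (covec_ext w1) (covec_ext w2)) phi set0.
  by rewrite contr_wedge contr_covec_deg1 // ext_coefZ ext_basisE eqxx mulr1.
rewrite !E /covec_ext wedge_deg1C -scaleN1r contrZl ext_coefZ.
by rewrite mulN1r.
Qed.

(** The product [w(phi) /\ phi^(n)] is the contraction of [phi^(n+1)], whose degree [2n + 2] exceeds
    [dim V]. *)
Lemma pfaff_skew w : pfaff (skew w) = 0.
Proof.
rewrite /pfaff vec_ext_skew -contr_divpow // (_ : divpow n.+1 phi = 0).
  by rewrite linear0 /ext_top ext_coef0.
apply: (@homog_large _ _ (2 * n.+1)); last exact: homog_divpow.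
by rewrite dimV mulnS addSn add1n.
Qed.

Definition pfaff3 z v u : R^o :=
  ext_top (wedge (vec_ext z) (wedge (vec_ext v) (wedge (vec_ext u) psi))).

Lemma pfaff3_linear v u : linear (fun z => pfaff3 z v u).
Proof. by move=> r z z'; rewrite /pfaff3 vec_ext_linear wedgePl ext_top_linear. Qed.

Lemma pfaff3_swap z v u : pfaff3 z v u = - pfaff3 v z u.
Proof. by rewrite /pfaff3 /vec_ext wedge_deg1CA ext_topN. Qed.

(** Contract [v /\ u /\ phi^(n)], which is zero by degree, with [w], and use
    [w(phi^(n)) = w(phi) /\ phi^(n-1)]; positivity of [n] enters here. *)
Lemma pfaff3_skew w v u : pfaff3 (skew w) v u = w u * pfaff v - w v * pfaff u.
Proof.
have vu0 : wedge (vec_ext v) (wedge (vec_ext u) phin) = 0.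
  apply: (@homog_large _ _ (1 + (1 + 2 * n))); first by rewrite dimV.
  do 2 (apply: homog_wedge; first exact: homog_vec_ext).
  exact: homog_divpow.
have := contr_covec_wedge w v (wedge (vec_ext u) phin).
rewrite vu0 linear0 contr_covec_wedge -[in contr _ phin](prednK n_gt0).
rewrite contr_divpow // -vec_ext_skew linearB /= linearZ /= => /(congr1 (@ext_top R _)).
(* Moving a vector past two others costs two signs. *)
have swap : wedge (vec_ext v) (wedge (vec_ext u) (wedge (vec_ext (skew w)) psi)) =
    wedge (vec_ext (skew w)) (wedge (vec_ext v) (wedge (vec_ext u) psi)).
  by rewrite /vec_ext (wedge_deg1CA (vcoord u)) linearN /= wedge_deg1CA opprK.
rewrite swap /ext_top !(ext_coefD, ext_coefZ, =^~ scaleN1r) ext_coef0.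
rewrite -!/(ext_top _) -/(pfaff u) -/(pfaff v) -/(pfaff3 _ _ _) => E.
rewrite scaleN1r; apply/eqP; rewrite -subr_eq0 [X in _ == X]E; apply/eqP.
move: (w v : R) (w u : R) (pfaff u : R) (pfaff v : R) (pfaff3 _ _ _ : R) => *; ring.
Qed.

Definition pfaff_covec : 'Hom(V, R^o) := ext_covec (ext_deg1 (fun i => pfaff (vbase i))).

Lemma pfaff_covecE v : pfaff_covec v = pfaff v.
Proof. exact: (ext_covec_deg1E (lin_of pfaff_linear)). Qed.

(** By antisymmetry this is the transpose of [pfaff_skew]. *)
Lemma skew_pfaff_covec : skew pfaff_covec = 0.
Proof.
by apply: covec_separates => w; rewrite skew_anti pfaff_covecE pfaff_skew oppr0 linear0.
Qed.

Lemma pfaff_covec_scale_linear : linear (fun r : R^o => r *: pfaff_covec).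
Proof. by move=> r s t; rewrite scalerDl scalerA. Qed.

Definition pfaff_homotopy u v : 'Hom(V, R^o) :=
  ext_covec (ext_deg1 (fun i => pfaff3 (vbase i) v u)).

Lemma pfaff_homotopyE u v z : pfaff_homotopy u v z = pfaff3 z v u.
Proof. exact: (ext_covec_deg1E (lin_of (pfaff3_linear v u))). Qed.

Lemma pfaff_homotopy_linear u : linear (pfaff_homotopy u).
Proof.
move=> r v v'; apply/lfunP => z; rewrite !lfunE /= lfunE /= !pfaff_homotopyE.
(* Linearity of [pfaff3] is available in its first argument, so [v] is moved there. *)
rewrite pfaff3_swap pfaff3_linear (pfaff3_swap z v) (pfaff3_swap z v').
by rewrite scalerN -opprD.
Qed.

(** The outer homotopies are evaluation at [u] and multiplication of [u] by scalars. The two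
    identities involving the middle one are [pfaff3_skew], tested on vectors and on covectors
    respectively. *)
Lemma pfaff_null_homotopic u :
  null_homotopic (lin_of pfaff_covec_scale_linear) (lin_of skew_linear) (lin_of pfaff_linear)
    (pfaff u).
Proof.
have ev_lin : linear (fun w : 'Hom(V, R^o) => w u) by move=> r w w'; rewrite !lfunE /= lfunE.
have sc_lin : linear (fun r : R^o => r *: u) by move=> r s t; rewrite scalerDl scalerA.
exists (lin_of ev_lin), (lin_of (pfaff_homotopy_linear u)), (lin_of sc_lin); split=> z /=.
- by rewrite lfunE /= pfaff_covecE [LHS]mulrC.
- apply/lfunP => v; rewrite !lfunE /= lfunE /= pfaff_homotopyE pfaff_covecE.
  by rewrite pfaff3_swap pfaff3_skew opprB subrK mulrC.
apply: covec_separates => w; rewrite linearD !linearZ /= skew_anti pfaff_homotopyE.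
by rewrite pfaff3_skew opprB addrCA [w u * _]mulrC subrr addr0 [LHS]mulrC.
Qed.

(** A set of [2n] indices misses a single [i], and the coefficient of [phi^(n)] there is
    [pfaff (vbase i)] up to sign. Hence the homotopies cover the ideal whose grade is assumed. *)
Lemma ext_pair_pfaff (t : extalg R (dim V)) : t \in homog (2 * n) ->
  exists u, pfaff u = ext_pair phin t.
Proof.
move=> /homogP ht; rewrite /ext_pair contrE.
apply: (big_ind (fun r => exists u, pfaff u = r)) => [|r s [u <-] [v <-]|S _].
- by exists 0; apply: (linear0 (lin_of pfaff_linear)).
- by exists (u + v); apply: (linearD (lin_of pfaff_linear)).
rewrite setU0; case: (eqVneq #|S| (2 * n)%N) => [Sn|/ht ->]; last first.
  by exists 0; rewrite mulr0; apply: (linear0 (lin_of pfaff_linear)).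
have /cards1P[i iS] : #|~: S| == 1%N.
  by rewrite -(eqn_add2l #|S|) cardsC Sn card_ord addn1 dimV.
have SE : S = setT :\ i by rewrite -[LHS]setCK iS setTD.
have pi : pfaff (vbase i) = ext_sign R [set i] S * phin S.
  rewrite /pfaff /ext_top vec_ext_base wedgeE (bigD1 [set i]) ?subsetT //=.
  rewrite big1 ?addr0 => [|K /andP[_ /negPf Ki]]; last by rewrite ext_basisE Ki mulr0 mul0r.
  by rewrite ext_basisE eqxx mulr1 SE.
exists ((ext_sign R S S * t S * ext_sign R [set i] S) *: vbase i).
rewrite -[LHS]/(lin_of pfaff_linear _) linearZ /= pi.
transitivity (ext_sign R S S * phin S * t S * (ext_sign R [set i] S * ext_sign R [set i] S)).
  by rewrite -[LHS]/(_ * _); ring.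
by rewrite ext_sign_sqr mulr1.
Qed.

(** Up to a sign, the first component of [d3] is therefore the first map of the Buchsbaum-Eisenbud
    complex. *)
Lemma ext_covec_contr_phin (t : extalg R (dim V)) : t \in homog (dim V) ->
  ext_covec (contr phin t) = (ext_sign R [set: 'I_(dim V)] setT * ext_top t) *: pfaff_covec.
Proof.
move=> ht; apply/lfunP => v; rewrite lfunE /= pfaff_covecE.
rewrite (@ext_covec_contr _ _ (2 * n)) ?homog_divpow //.
by rewrite ext_pair_top // -/(pfaff v) mulrAC.
Qed.

Section Exactness.
Hypothesis pf_grade : has_grade (im (fun t : dextp V (2 * n) => ext_pair phin t)) 3.

Let homotopies y : im (fun t : dextp V (2 * n) => ext_pair phin t) y ->
  null_homotopic (lin_of pfaff_covec_scale_linear) (lin_of skew_linear) (lin_of pfaff_linear) y.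
Proof.
move=> [t <-]; have [u <-] := ext_pair_pfaff (extp_homog (t : extp V (2 * n))).
exact: pfaff_null_homotopic.
Qed.

Lemma skew_kernel w : skew w = 0 -> exists r : R, w = r *: pfaff_covec.
Proof.
move=> w0; have [|r rw] := null_homotopic_exact2 (d2 := lin_of skew_linear) pf_grade homotopies
  (free_module_vect _) (free_module_vect _) (z := w); first exact: w0.
by exists r.
Qed.

Lemma pfaff_kernel v : pfaff v = 0 -> exists w, skew w = v.
Proof.
apply: (null_homotopic_exact1 (d2 := lin_of skew_linear) (d1 := lin_of pfaff_linear)
  pf_grade homotopies (free_module_vect _) (free_module_vect _) (free_module_vect _)) => r.
by rewrite -[LHS]/(lin_of skew_linear _) linearZ /= skew_pfaff_covec scaler0.
Qed.

End Exactness.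
End Pfaffians.

(** * The resolution *)

Section Hyperplane.
Variables (R : comNzRingType) (V : vectType R) (v0 : V) (w0 : 'Hom(V, R^o)).
Hypothesis w0v0 : w0 v0 = 1.

Lemma hkerP (v : hker w0) : w0 (v : V) = 0.
Proof. by have := valP v; rewrite inE => /eqP. Qed.

Lemma hker_inj (u v : hker w0) : (u : V) = v -> u = v.
Proof. exact: val_inj. Qed.

Lemma projE (v : V) : (proj w0v0 v : V) = v - w0 v *: v0.
Proof. by []. Qed.

Lemma hker_valD (u v : hker w0) : ((u + v : hker w0) : V) = (u : V) + (v : V).
Proof. by []. Qed.

Lemma hker_valZ (r : R) (u : hker w0) : ((r *: u : hker w0) : V) = r *: (u : V).
Proof. by []. Qed.

Lemma proj_linear : linear (proj w0v0).
Proof.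
move=> r u v; apply: hker_inj; rewrite hker_valD hker_valZ !projE linearP scalerDl scalerBr.
by rewrite scalerA opprD addrACA.
Qed.

(* [hker w0] is stably free but need not be free, so a coordinate is borrowed from the other
   factor to recover [V]. *)
Lemma hker_row_iso k : isomorphic (hker w0 * 'rV[R]_(1 + k))%type (V * 'rV[R]_k)%type.
Proof.
(* The first coordinate of the row becomes the coefficient of [v0]. *)
pose f (z : hker w0 * 'rV[R]_(1 + k)) : V * 'rV[R]_k :=
  ((z.1 : V) + z.2 0 0 *: v0, rsubmx z.2).
have f_lin : linear f.
  move=> r [u s] [v t]; rewrite /f /= linearP; congr (_, _).
  rewrite !mxE -[LHS]/(r *: hker_val u + hker_val v + (r * s 0 0 + t 0 0) *: v0).
  rewrite -[RHS]/(r *: (hker_val u + s 0 0 *: v0) + (hker_val v + t 0 0 *: v0)).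
  by rewrite scalerDl scalerDr scalerA addrACA.
exists (lin_of f_lin); exists (fun z : V * 'rV[R]_k => (proj w0v0 z.1, row_mx (w0 z.1)%:M z.2)).
  move=> [v s]; have w0v : w0 ((v : V) + s 0 0 *: v0) = s 0 0.
    by rewrite linearD linearZ /= hkerP w0v0 add0r [LHS]mulr1.
  congr (_, _); first by apply: hker_inj; rewrite projE /= w0v addrK.
  rewrite /= w0v -[RHS]hsubmxK; congr row_mx; apply/rowP => i.
  by rewrite !mxE ord1 eqxx mulr1n; congr (s _ _); apply: val_inj.
move=> [v s]; rewrite /= /f /= row_mxKr; congr (_, _).
rewrite -[LHS]/(v - w0 v *: v0 + (row_mx (w0 v)%:M s : 'rV[R]_(1 + k)) 0 0 *: v0).
have -> : (0 : 'I_(1 + k)) = lshift k 0 by apply: val_inj.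
by rewrite row_mxEl mxE eqxx mulr1n subrK.
Qed.

Lemma free_hker_prod (U : vectType R) : (0 < dim U)%N -> free_module (hker w0 * U)%type.
Proof.
case dimU: (dim U) => [//|k] _.
have Uk : isomorphic U 'rV[R]_(1 + k).
  rewrite add1n -dimU; exists (v2r : {linear U -> 'rV[R]_(dim U)}).
  by exists r2v; [apply: v2rK|apply: r2vK].
have hh : isomorphic (hker w0) (hker w0) by exists (idfun : {linear hker w0 -> hker w0}); exists id.
apply: free_module_iso (isomorphic_prod hh Uk) _.
exact: free_module_iso (hker_row_iso k) (free_module_vect _).
Qed.

End Hyperplane.

Lemma linear_injective (R : comNzRingType) (M N : lmodType R) (f : M -> N) :
  linear f -> (forall z, f z = 0 -> z = 0) -> injective f.
Proof.
move=> f_lin f0 u v fuv; apply/eqP; rewrite -subr_eq0; apply/eqP/f0.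
by rewrite -[LHS]/(lin_of f_lin _) linearB /= fuv subrr.
Qed.

(** Both factors of each generating product are killed by [w0]. Thus [w0(phi)] will reduce to the
    contraction of [v0 /\ v0'], which is [v0']. *)
Lemma ext2_ker_contr (R : comNzRingType) (V : vectType R) (w0 : 'Hom(V, R^o)) (phi' : extp V 2) :
  ext2_ker w0 phi' -> contr (covec_ext w0) phi' = 0.
Proof.
apply: (submod_gen_sub (B := fun b : extalg R (dim V) => contr (covec_ext w0) b = 0)).
- move=> b [v [v' ->]]; rewrite contr_covec_wedge hkerP scale0r sub0r.
  by rewrite contr_covec_deg1 ?homog_vec_ext // vec_extK hkerP scale0r linear0 oppr0.
- exact: linear0.
by move=> r a b ha hb; rewrite linearP /= ha hb scaler0 addr0.
Qed.

Theorem theorem5p4 (R : comNzRingType) (n : nat) (U V : vectType R)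
    (v0 : V) (w0 : 'Hom(V, R^o))
    (phi : extp V 2) (phi' : extp V 2) (v0' : hker w0)
    (x : 'Hom(U, R^o))
    (q : {linear 'Hom(V, R^o) -> U})
    (B : {linear dextp V (2 * n).+1 -> extp U 2})
    (R_noeth : noetherian R) (n_gt0 : (0 < n)%N)
    (dimU : dim U = 3%N) (dimV : dim V = (2 * n).+1)
    (v0_summand : generates_free_summand1 v0) (w0v0 : w0 v0 = 1)
    (phi'_ker : ext2_ker w0 phi')
    (phiE : (phi : extalg R (dim V)) =
       (phi' : extalg R (dim V)) + wedge (vec_ext v0) (vec_ext v0')) :
  let phin := divpow n phi in
  let J := ideal_add
    (fun r => exists (v' : hker w0) (w : dextp V (2 * n).+1),
        ext_pair (wedge (vec_ext v') phin) w = r)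
    (ideal_mul (im x)
       (im (fun w : dextp V (2 * n).+1 => ext_pair (wedge (vec_ext v0) phin) w))) in
  forall
    (im_x_grade : has_grade (im x) 3)
    (phin_gor : gorenstein_grade3 (im (fun w : dextp V (2 * n) => ext_pair phin w)))
    (im_v0' : forall r, im (fun w : 'Hom(V, R^o) => w (v0' : V)) r -> im x r)
    (v0phin_reg : nonzerodivisor (ext_top (wedge (vec_ext v0) phin)))
    (qE : forall w : 'Hom(V, R^o), x (q w) = w (v0' : V))
    (BE : forall w : dextp V (2 * n).+1,
        ext_vec (contr (covec_ext x) (B w : extp U 2)) = q (ext_covec (contr phin w))),
  let d3 (z : dextp V (2 * n).+1 * extp U 3) : 'Hom(V, R^o) * extp U 2 :=
    (ext_covec (contr phin z.1), B z.1 + hcomp 2 (contr (covec_ext x) z.2)) in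
  let d2 (z : 'Hom(V, R^o) * extp U 2) : hker w0 * U :=
    (proj w0v0 (ext_vec (contr (covec_ext z.1) phi)),
     - q z.1 + ext_vec (contr (covec_ext x) z.2)) in
  let d1 (z : hker w0 * U) : extp V (2 * n).+1 :=
    hcomp (2 * n).+1 (wedge (vec_ext ((hker_val z.1) + x z.2 *: v0)) phin) in
  free_resolution3 (ring_mod J) d3 d2 d1.
Proof.
move=> phin J im_x_grade [[_ pf_grade _] _] _ v0phin_reg qE BE d3 d2 d1.
have phi2 : (phi : extalg R (dim V)) \in homog 2 := extp_homog phi.
pose pf := pfaff n (phi : extalg R (dim V)); pose pfc := pfaff_covec n (phi : extalg R (dim V)).
pose sk := skew (phi : extalg R (dim V)).
have sk_w0 w : w0 (sk w) = - w (v0' : V).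
  rewrite /sk skew_anti // /skew phiE linearD /= ext2_ker_contr // contr_covec_wedge.
  rewrite contr_covec_deg1 ?homog_vec_ext // vec_extK hkerP w0v0 scale0r linear0.
  by rewrite scale1r add0r subr0 vec_extK.
pose sT := ext_sign R [set: 'I_(dim V)] setT.
have sTK : sT * sT = 1 by apply: ext_sign_sqr.
(* [top] inverts the identification of the top exterior power with [R]; equalities there are checked
   on coefficients. *)
pose top (r : R) : extp V (2 * n).+1 := hcomp _ (r *: ext_basis R setT).
have topE (r : R) : top r = r *: ext_basis R setT :> extalg R (dim V).
  apply: hcompE; apply: rpredZ; have := homog_basis R [set: 'I_(dim V)].
  by rewrite cardsT card_ord [X in homog X]dimV.
have top_top r : ext_top (top r) = r.
  by rewrite topE /ext_top ext_coefZ ext_basisE eqxx mulr1.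
have extp_top_inj (a b : extp V (2 * n).+1) : ext_top a = ext_top b -> a = b.
  by move=> ab; apply/extp_inj/(ext_top_inj dimV (extp_homog a) (extp_homog b)).
have homogT (a : extp V (2 * n).+1) : (a : extalg R (dim V)) \in homog (dim V).
  by rewrite [X in homog X]dimV extp_homog.
have topD (r : R) (a b : extp V (2 * n).+1) :
    ext_top (r *: a + b : extp V (2 * n).+1) = r * ext_top a + ext_top b.
  by rewrite extpD extpZ [LHS]ext_top_linear.
have pairE (v : V) (w : dextp V (2 * n).+1) :
    ext_pair (wedge (vec_ext v) phin) w = sT * pf v * ext_top w.
  exact: ext_pair_top (homogT w).
have covE (w : dextp V (2 * n).+1) : ext_covec (contr phin w) = (sT * ext_top w) *: pfc.
  exact: ext_covec_contr_phin (homogT w).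
have xx (a : extp U 2) : x (ext_vec (contr (covec_ext x) a)) = 0.
  have := contr_covecK x a; rewrite contr_covec_deg1; last first.
    exact: (homog_contr (p := 1) (r := 2) _ (homog_deg1 _) (extp_homog a)).
  by move=> /(congr1 (fun b : extalg _ _ => b set0));
    rewrite ext_coefZ ext_basisE eqxx mulr1 ext_coef0.
have pfZD r u v : pf (r *: u + v) = r * pf u + pf v by apply: pfaff_linear.
have d3_lin : linear d3.
  move=> r [a b] [c d]; congr (_, _).
    rewrite -[LHS]/(ext_covec (contr phin (r *: a + c : extp V _))) covE topD.
    by rewrite -[RHS]/(r *: ext_covec (contr phin (a : extp V (2 * n).+1)) +
        ext_covec (contr phin (c : extp V (2 * n).+1))) !covE scalerA -scalerDl mulrDr mulrCA.
  have Hlin : hcomp 2 (contr (covec_ext x) (r *: b + d : extp U 3)) =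
      r *: hcomp 2 (contr (covec_ext x) (b : extp U 3)) +
      hcomp 2 (contr (covec_ext x) (d : extp U 3)) :> extp U 2.
    exact: (@koszul_diff_linear _ _ x 2).
  by rewrite /= linearP [X in _ + X = _]Hlin addrACA -scalerDr.
have d2_lin : linear d2.
  move=> r [a b] [c d]; congr (_, _); rewrite /=.
    by rewrite -[ext_vec _]/(sk _) /sk skew_linear proj_linear.
  rewrite -[LHS]/(- q (r *: a + c) + ext_vec (contr (covec_ext x) (r *: b + d : extp U 2))).
  by rewrite [q _]linearP opprD extpD extpZ [contr _ _]linearP /= ext_vec_linear
    addrACA -scalerN -scalerDr.
have d1_top z : ext_top (d1 z : extp V _) = pf ((z.1 : V) + x z.2 *: v0).
  rewrite /d1 hcompE //; apply: (homog_wedge (p := 1)); first exact: homog_vec_ext.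
  exact: homog_divpow.
have d1_lin : linear d1.
  move=> r [a b] [c d]; apply: extp_top_inj; rewrite extpD extpZ.
  rewrite [RHS]ext_top_linear !d1_top -pfZD.
  rewrite -[LHS]/(pf (r *: hker_val a + hker_val c + x (r *: b + d) *: v0)).
  by rewrite [x _]linearP /= -[r *: x b]/(r * x b) scalerDl addrACA -scalerA -scalerDr.
pose p0 : R := pf v0.
have pf_split v (r : R) : pf (v + r *: v0) = pf v + r * p0 by rewrite addrC pfZD addrC.
have pf0 : pf 0 = 0 by apply: (linear0 (lin_of (pfaff_linear n _))).
have vec_ext0 : vec_ext (0 : U) = 0 by apply: (linear0 (lin_of (@vec_ext_linear R U))).
(* [J] is the image of [d1] read in [R]. Its second summand consists of the single products
   [x u * p0], because [p0] is fixed and [x] is linear. *)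
have JE r : J r <-> exists (v' : hker w0) u, r = pf ((v' : V) + x u *: v0).
  split=> [[a [b [[v' [w <-]] hb ->]]]|[v' [u ->]]].
    have [u ->] : exists u, b = x u * p0.
      move: hb; apply: (submod_gen_sub (M := R^o) (B := fun b => exists u, b = x u * p0)).
      - move=> s [a' [b' [[u <-] [w' <-] ->]]]; rewrite pairE.
        exists ((sT * ext_top (w' : extp V _)) *: u); rewrite linearZ /=.
        by rewrite -[_ *: x u]/(_ * x u) -/p0; ring.
      - by exists 0; rewrite linear0 mul0r.
      by move=> s a' b' [u' ->] [v ->]; exists (s *: u' + v); rewrite linearP mulrDl -mulrA.
    exists ((sT * ext_top (w : extp V _)) *: v'), u.
    rewrite pf_split pairE -[in RHS](addr0 (_ *: v')) hker_valD hker_valZ pfZD.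
    by rewrite pf0 addr0 mulrAC.
  exists (pf v'), (x u * p0); split; last exact: pf_split.
    (* The coefficient [sT] cancels the sign of the pairing. *)
    by exists v', (top sT : dextp V _); rewrite pairE top_top mulrAC sTK mul1r.
  apply: sub_submod_gen; exists (x u), p0; split=> //; first by exists u.
  by exists (top sT : dextp V _); rewrite pairE top_top mulrAC sTK mul1r.
have skc (r : R) : sk (r *: pfc) = 0.
  rewrite -[LHS]/(lin_of (skew_linear _) _) linearZ /= -[X in _ *: X]/(sk pfc).
  by rewrite /sk /pfc skew_pfaff_covec // scaler0.
have d3_mem z : d2 (d3 z) = 0.
  case: z => a b; rewrite /d2 /d3 /=; congr (_, _).
    by apply: hker_inj; rewrite projE -[ext_vec _]/(sk _) covE skc linear0 scale0r subr0.
  rewrite -[LHS]/(- q (ext_covec (contr phin (a : extp V _))) + ext_vec (contr (covec_ext x)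
    (B a + hcomp 2 (contr (covec_ext x) (b : extp U 3)) : extp U 2))).
  have xbE := koszul_diffE x (b : extp U 3).
  by rewrite extpD [contr _ (_ + _)]linearD /= [X in _ + contr _ X]xbE contr_covecK addr0 BE addNr.
split.
- split.
  + exact: (free_module_prod (free_extpow _ _ _) (free_extpow _ _ _)).
  + exact: (free_module_prod (free_module_vect _) (free_extpow _ _ _)).
  + by have := free_hker_prod w0v0 (_ : 0 < dim U)%N; rewrite dimU; apply.
  + exact: free_extpow.
- by [].
- split.
  + apply: linear_injective d3_lin _ => -[a b] d3ab; have /= xb := congr1 snd d3ab.
    (* Evaluation at [v0] turns the first component into a multiple of the regular element [p0],
       which forces [a = 0]; what remains is a Koszul cycle in top degree. *)
    have /= := congr1 fst d3ab; rewrite covE => /(congr1 (fun w : 'Hom(V, R^o) => w v0)).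
    rewrite !lfunE /= pfaff_covecE => pa.
    have a0 : a = 0.
      apply: extp_top_inj; rewrite [RHS]ext_coef0 -[LHS]mul1r -sTK -mulrA.
      by rewrite [X in _ * X]v0phin_reg ?mulr0 // mulrC.
    by move: xb; rewrite a0 linear0 add0r => xb; rewrite (koszul_inj3 dimU im_x_grade xb).
  + move=> [w u]; split=> [|[z <-]]; last exact: d3_mem.
    move=> d2wu; have skw := congr1 (fun z => hker_val z.1) d2wu.
    have /= /eqP := congr1 snd d2wu; rewrite addrC subr_eq0 => /eqP qw.
    (* A vector killed by [proj] is [w0] of it times [v0]; here the scalar is [- x (q w)], and [q w]
       is a Koszul boundary. *)
    have skw0 : sk w = 0.
      by move: skw; rewrite projE -[ext_vec _]/(sk _) sk_w0 -qE -qw xx oppr0 scale0r subr0.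
    have [r rw] := skew_kernel n_gt0 dimV phi2 pf_grade skw0.
    pose a := top (sT * r).
    have aw : ext_covec (contr phin a) = w.
      by rewrite covE top_top mulrA sTK mul1r rw.
    (* With [w] now equal to [phi^(n)(a)], the property of [B] makes [u - B a] a Koszul cycle. *)
    have [|y yE] := koszul_exact2 dimU im_x_grade (z := u - B a).
      rewrite -[LHS]ext_vecK; last first.
        exact: (homog_contr (p := 1) (r := 2) _ (homog_deg1 _) (extp_homog _)).
      rewrite -scaleN1r addrC extpD extpZ [contr _ _]linearP /= ext_vec_linear scaleN1r.
      by rewrite BE aw -qw addNr vec_ext0.
    by exists (a : dextp V _, y); rewrite /d3 /= aw yE addrC subrK.
  move=> [v u]; split=> [vu0|[z <-]].
    have /(pfaff_kernel n_gt0 dimV phi2 pf_grade)[w wE] : pf (hker_val v + x u *: v0) = 0.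
      by rewrite -[LHS](d1_top (v, u)) vu0 /ext_top ext_coef0.
    have xuE : w0 (hker_val v + x u *: v0) = x u.
      by rewrite linearD linearZ /= hkerP w0v0 add0r [LHS]mulr1.
    (* Apply [w0] to [A w = v + x(u) v0]: the left side gives [- x (q w)], the right side [x u]. *)
    have qu : x (u + q w) = 0.
      by rewrite linearD /= qE -xuE -wE sk_w0 addNr.
    have [y yE] := koszul_exact1 dimU im_x_grade qu.
    exists (w, y); congr (_, _) => /=; last by rewrite yE addrC addrK.
    by apply: hker_inj; rewrite projE -[ext_vec _]/(sk w) [sk w]wE xuE addrK.
  (* The vector to which [pf] is applied is [A w] again: the second component restores the multiple
     of [v0] removed by [proj]. *)
  apply: extp_top_inj; rewrite d1_top [RHS]ext_coef0 /= -[ext_vec _]/(sk _) linearD linearN /=.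
  by rewrite xx addr0 qE sk_w0 scaleNr subrK; apply: pfaff_skew.
(* The augmentation takes the class of the top coefficient modulo [J]. *)
have e_lin : linear (fun y : extp V (2 * n).+1 =>
    quotmod_pi (submod_gen (J : R^o -> Prop)) (ext_top y)).
  by move=> r a b; rewrite topD linearP.
exists (lin_of e_lin); split=> [z|]; last move=> /= y.
  by have [r <-] := quotmod_pi_repr z; exists (top r); rewrite /= top_top.
(* By [JE] the set [J] is closed under linear combinations, so it equals the ideal it generates. *)
have J_mem : quotmod_pi (submod_gen (J : R^o -> Prop)) (ext_top (y : extp V _)) = 0 <->
    J (ext_top (y : extp V _)).
  have J0 : J 0 by apply/JE; exists 0, 0; rewrite linear0 scale0r addr0 pf0.
  have Jlin (r s t : R) : J s -> J t -> J (r * s + t).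
    move=> /JE[v [u ->]] /JE[v' [u' ->]]; apply/JE; exists (r *: v + v'), (r *: u + u').
    rewrite -pfZD hker_valD hker_valZ [x (_ + _)]linearP /= -[r *: x u]/(r * x u).
    by rewrite scalerDl addrACA -scalerA -scalerDr.
  apply: iff_trans (mem_submod_genE (ext_top (y : extp V _) : R^o) J0 Jlin).
  by have := quotmod_pi_eq (submod_gen (J : R^o -> Prop)) (ext_top (y : extp V _)) 0;
    rewrite raddf0 subr0.
split=> [/J_mem/JE[v [u yE]]|[z zy]].
  by exists (v, u); apply: extp_top_inj; rewrite d1_top yE.
by apply/J_mem/JE; exists z.1, z.2; rewrite -zy d1_top.
Qed.
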